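(* For $n,k\ge0$ let $j_{n,k}$ be the number of intervals $[P,Q]$ in $\mathbb{F}_n^2$ such that the length of the first ascent of $Q$ minus the length of the first ascent of $P$ equals $k$. Then $$\sum_{n,k\ge0}j_{n,k}x^ny^k=\frac{1+x-x^2+\sqrt{x^4-2x^3-x^2-2x+1}}{(1-x^2)\sqrt{x^4-2x^3-x^2-2x+1}+1+x^4-x^3-2(y+1)x^2-x}.$$ The generating function of the number of intervals of $\mathbb{F}_n^2$ is $$\frac{-x^2+3x-1+\sqrt{x^4-2x^3-x^2-2x+1}}{2x(x^2-3x+1)(x+1)},$$ and the number of intervals in $\mathbb{F}_n^2$ is asymptotically $$\frac{11+5\sqrt5}{20}\sqrt{\frac{14\sqrt5-30}{\pi}}\cdot n^{-1/2}\left(\frac{3+\sqrt5}{2}\right)^n.$$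
   Context: A Dyck path of semilength $n\ge 0$ is a lattice path from $(0,0)$ to $(2n,0)$ with steps $U=(1,1)$ and $D=(1,-1)$ that never goes below the $x$-axis; it is identified with its word over $\{U,D\}$. A path avoids a pattern $\alpha$ if $\alpha$ does not occur as a factor (block of consecutive steps). $\mathcal{F}_n^2$ is the set of Dyck paths of semilength $n$ avoiding $DUU$ and $DDD$, ordered by the Stanley order: $P\le Q$ iff $P$ lies weakly below $Q$ when both are drawn in the plane; $\mathbb{F}_n^2=(\mathcal{F}_n^2,\le)$. An interval is $[P,Q]=\{R:P\le R\le Q\}$ with $P\le Q$ (including $P=Q$). The first ascent of a nonempty Dyck path is its maximal initial run of $U$ steps; for the empty path take its length to be $0$. *)

(* Defs.v *)
From HB Require Import structures.
From mathcomp Require Import all_boot all_order all_algebra.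
From mathcomp Require Export fraction.
From mathcomp Require Import all_classical all_reals all_analysis.

Set Implicit Arguments.
Unset Strict Implicit.
Unset Printing Implicit Defensive.

Import Order.TTheory GRing.Theory Num.Theory.

Local Open Scope ring_scope.

(** * Dyck paths avoiding DUU and DDD *)

Definition U : bool := true.
Definition D : bool := false.

(* Ordinate of the path spelled by [w] at abscissa [i]. *)
Definition height (w : seq bool) (i : nat) : int :=
  (count_mem U (take i w))%:Z - (count_mem D (take i w))%:Z.

Definition dyck (w : seq bool) : bool :=
  [forall i : 'I_(size w).+1, 0 <= height w i] && (height w (size w) == 0).

Definition avoids (alpha w : seq bool) : bool := ~~ infix alpha w.

Definition F2 (n : nat) : {set (n.*2).-tuple bool} :=
  [set w : (n.*2).-tuple bool |
    [&& dyck w, avoids [:: D; U; U] w & avoids [:: D; D; D] w]].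

(* Paths are affine between consecutive integer abscissae, so it is enough to
   compare them there. *)
Definition stanley (n : nat) (P Q : (n.*2).-tuple bool) : bool :=
  [forall i : 'I_(n.*2).+1, height P i <= height Q i].

Definition stanley_interval (n : nat) (P Q : (n.*2).-tuple bool) :
    {set (n.*2).-tuple bool} :=
  [set R in F2 n | stanley P R && stanley R Q].

Definition intervals (n : nat) : {set {set (n.*2).-tuple bool}} :=
  [set stanley_interval P Q | P in F2 n, Q in F2 n & stanley P Q].

(* [index] returns the position of the first down step, and [size w] when there
   is none. *)
Definition first_ascent (w : seq bool) : nat := index D w.

Definition intervals_ascent (n k : nat) : {set {set (n.*2).-tuple bool}} :=
  [set stanley_interval P Q | P in F2 n, Q in F2 n &
    stanley P Q && ((first_ascent Q)%:Z - (first_ascent P)%:Z == k%:Z)].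

Definition j (n k : nat) : nat := #|intervals_ascent n k|.

(** * Formal power series *)

Record fps (R : Type) := Fps { fps_coef :> nat -> R }.

Notation "{ 'fps' R }" := (fps R) (at level 0, format "{ 'fps'  R }").

HB.instance Definition _ (R : Type) := gen_eqMixin {fps R}.
HB.instance Definition _ (R : Type) := gen_choiceMixin {fps R}.

Lemma fpsP (R : Type) (a b : {fps R}) : a =1 b <-> a = b.
Proof.
by split=> [|-> //]; case: a b => [a] [b] /= /funext ->.
Qed.

Section Zmodule.
Variable R : zmodType.
Implicit Types a b : {fps R}.

Definition fps_zero : {fps R} := Fps (fun=> 0).
Definition fps_opp a : {fps R} := Fps (fun n => - a n).
Definition fps_add a b : {fps R} := Fps (fun n => a n + b n).

Fact fps_addA : associative fps_add.
Proof. by move=> a b c; apply/fpsP => n /=; rewrite addrA. Qed.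
Fact fps_addC : commutative fps_add.
Proof. by move=> a b; apply/fpsP => n /=; rewrite addrC. Qed.
Fact fps_add0 : left_id fps_zero fps_add.
Proof. by move=> a; apply/fpsP => n /=; rewrite add0r. Qed.
Fact fps_addN : left_inverse fps_zero fps_opp fps_add.
Proof. by move=> a; apply/fpsP => n /=; rewrite addNr. Qed.

HB.instance Definition _ := GRing.isZmodule.Build {fps R}
  fps_addA fps_addC fps_add0 fps_addN.

End Zmodule.

Section ComRing.
Variable R : comNzRingType.
Implicit Types a b c : {fps R}.

Definition fps_C (r : R) : {fps R} := Fps (fun n => if n == 0%N then r else 0).
Definition fps_X : {fps R} := Fps (fun n => (n == 1%N)%:R).
Definition fps_mul a b : {fps R} :=
  Fps (fun n => \sum_(i < n.+1) a i * b (n - i)%N).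

Definition fps_trunc m a : {poly R} := \poly_(i < m.+1) a i.

Lemma fps_coef_mul m n a b :
  (n <= m)%N -> fps_mul a b n = (fps_trunc m a * fps_trunc m b)`_n.
Proof.
move=> nm; rewrite coefM; apply: eq_bigr => i _.
have im : (i < m.+1)%N by rewrite ltnS (leq_trans _ nm) // -ltnS ltn_ord.
by rewrite !coef_poly im ltnS (leq_trans (leq_subr _ _) nm).
Qed.

Fact fps_mulC : commutative fps_mul.
Proof.
by move=> a b; apply/fpsP => n; rewrite !(@fps_coef_mul n n) // mulrC.
Qed.

Fact fps_mulA : associative fps_mul.
Proof.
move=> a b c; apply/fpsP => n.
transitivity (fps_trunc n a * (fps_trunc n b * fps_trunc n c))`_n.
  rewrite coefM; apply: eq_bigr => i _.
  by rewrite coef_poly ltn_ord (@fps_coef_mul n) // leq_subr.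
rewrite mulrA coefM; apply: eq_bigr => i _.
rewrite (@fps_coef_mul n) -1?ltnS ?ltn_ord //.
by rewrite coef_poly ltnS leq_subr.
Qed.

Fact fps_mul1 : left_id (fps_C 1) fps_mul.
Proof.
move=> a; apply/fpsP => n /=; rewrite big_ord_recl /= mul1r subn0.
by rewrite big1 ?addr0 // => i _; rewrite mul0r.
Qed.

Fact fps_mulDl : left_distributive fps_mul +%R.
Proof.
move=> a b c; apply/fpsP => n /=.
by rewrite -big_split; apply: eq_bigr => i _ /=; rewrite mulrDl.
Qed.

Fact fps_oner_neq0 : fps_C 1 != 0 :> {fps R}.
Proof. by apply/eqP => /fpsP/(_ 0%N)/eqP; rewrite /= oner_eq0. Qed.

HB.instance Definition _ := GRing.Zmodule_isComNzRing.Build {fps R}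
  fps_mulA fps_mulC fps_mul1 fps_mulDl fps_oner_neq0.

Definition fps_unit a : bool := `[< exists b, b * a = 1 >].
Definition fps_inv a : {fps R} :=
  if fps_unit a then xget 0 [set b | b * a = 1]%classic else a.

Fact fps_mulV : {in fps_unit, left_inverse 1 fps_inv *%R}.
Proof.
move=> a ua; rewrite /fps_inv ifT //.
by have /asboolP/(@xgetPex _ 0) := ua.
Qed.
Fact fps_unitP a b : b * a = 1 -> fps_unit a.
Proof. by move=> ba; apply/asboolP; exists b. Qed.
Fact fps_inv_out : {in [predC fps_unit], fps_inv =1 id}.
Proof.
move=> a /negbTE ua; have {}ua : fps_unit a = false := ua.
by rewrite /fps_inv ua.
Qed.

HB.instance Definition _ := GRing.ComNzRing_hasMulInverse.Build {fps R}
  fps_mulV fps_unitP fps_inv_out.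

End ComRing.

Section Idomain.
Variable R : idomainType.

Fact fps_mulf_eq0 (a b : {fps R}) : a * b = 0 -> (a == 0) || (b == 0).
Proof.
move=> ab0; apply/negPn/negP; rewrite negb_or => /andP[a0 b0].
have nz (c : {fps R}) : c != 0 -> exists n, c n != 0.
  move=> /eqP c0; apply/not_existsP => cn; apply: c0.
  by apply/fpsP => n; move/negP/negPn/eqP: (cn n).
case: (ex_minnP (nz _ a0)) => p ap pmin; case: (ex_minnP (nz _ b0)) => q bq qmin.
have /fpsP/(_ (p + q)%N) := ab0.
have pq : (p < (p + q).+1)%N by rewrite ltnS leq_addr.
rewrite /GRing.mul /= (bigD1 (Ordinal pq)) //= addKn big1 ?addr0.
  by apply/eqP; rewrite mulf_neq0.
move=> i; rewrite -val_eqE /= neq_ltn => /orP[ip|pi].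
  suff /eqP -> : a i == 0 by rewrite mul0r.
  by apply: contraLR ip => /pmin; rewrite -leqNgt.
suff /eqP -> : b (p + q - i)%N == 0 by rewrite mulr0.
apply: contraLR pi => /qmin; rewrite -leqNgt => qi.
have ipq : (i <= p + q)%N by rewrite -ltnS ltn_ord.
by move: qi; rewrite leq_subRL // leq_add2r.
Qed.

HB.instance Definition _ :=
  GRing.ComUnitRing_isIntegral.Build {fps R} fps_mulf_eq0.

End Idomain.

(* The square root with constant coefficient 1; the default value 0 is taken
   only by series that have no such square root. *)
Definition fps_sqrt (R : idomainType) (a : {fps R}) : {fps R} :=
  xget 0 [set s : {fps R} | s ^+ 2 = a /\ s 0%N = 1]%classic.

Lemma fps_sqrtE (R : idomainType) (s : {fps R}) :
  2%:R != 0 :> R -> s 0%N = 1 -> fps_sqrt (s ^+ 2) = s.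
Proof.
move=> two s0; apply: xget_unique => // t [/eqP + t0]; rewrite eqf_sqr.
move=> /orP[/eqP //|/eqP ts]; suff two0 : 2%:R = 0 :> R by rewrite two0 eqxx in two.
have tE : t 0%N = - s 0%N by rewrite ts.
by rewrite mulr2n -{1}t0 tE s0 addNr.
Qed.

(* Quotients of series are taken in the field of fractions, since a denominator
   such as 2x need not be invertible as a series. *)
Notation "a %:F" := (@FracField.tofrac _ a) : ring_scope.

(* Series in x and y are series in x whose coefficients are series in y. *)
Notation "{ 'fps2' R }" := {fps {fps R}} (at level 0, format "{ 'fps2'  R }").

Definition var_x (R : comNzRingType) : {fps2 R} := fps_X _.
Definition var_y (R : comNzRingType) : {fps2 R} := fps_C (fps_X R).

Definition gf_j : {fps2 rat} := Fps (fun n => Fps (fun k => (j n k)%:R)).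
Definition gf_intervals : {fps rat} := Fps (fun n => #|intervals n|%:R).

(* Main.v *)
(* A path of F2(n) is U^m followed by blocks U D and U D D, with m the number of
   blocks U D D; read from the right it is a composition of n into parts 1 and 2,
   and P <= Q means that the partial sums of Q dominate those of P. Cutting at
   the end of the shorter composition, a pair P <= Q becomes a Motzkin prefix
   (the difference of the partial sums) ending at some level d, followed by k
   parts of total d in P, where k is the difference of the first ascents. If M
   counts Motzkin paths, M = 1 + (x + x^2) M + x^3 M^2, and T = x^2 M, prefixes
   ending at level d are counted by M T^d, hence the intervals by
   M / (1 - y (T + T^2)).

   For the asymptotics let rho = (3 - sqrt 5) / 2, a root of x^2 - 3 x + 1. Up to
   a negligible term, 2 x times the interval series is G h with
   h = (1 - x / rho)^(-1/2), whose coefficients are central binomials, and G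
   absolutely convergent at 1/2 > rho. So the n-th coefficient of G h is
   equivalent to G(rho) times that of h, which Wallis' inequalities estimate.
   The value G(rho)^2 is algebraic, and G(rho) >= 0 as a limit of normalised
   interval counts. *)

Require Import Defs.
From HB Require Import structures.
From mathcomp Require Import all_boot all_order all_algebra.
From mathcomp Require Import all_classical all_reals all_analysis.
From mathcomp Require Import zify ring lra.

Set Implicit Arguments.
Unset Strict Implicit.
Unset Printing Implicit Defensive.

Import Order.TTheory GRing.Theory Num.Theory.
Import numFieldNormedType.Exports.

Local Open Scope classical_set_scope.
Local Open Scope ring_scope.

(** * Paths of F2 as compositions into parts 1 and 2 *)

(** In a composition, [false] stands for a part 1 and [true] for a part 2. *)
Definition part_sum (l : seq bool) : nat := (size l + count_mem true l)%N.

(** Words are spelled from the right end of the path, so the down steps of a block precede its up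
    step and the initial run of up steps comes last. *)
Fixpoint rev_blocks (l : seq bool) : seq bool :=
  if l is b :: l' then nseq b.+1 D ++ U :: rev_blocks l' else [::].

Definition rev_path (l : seq bool) (m : nat) : seq bool :=
  rev_blocks l ++ nseq m U.

Definition path_of (l : seq bool) : seq bool :=
  rev (rev_path l (count_mem true l)).

Lemma part_sum_cons b l : part_sum (b :: l) = (b.+1 + part_sum l)%N.
Proof. by rewrite /part_sum; case: b => /=; lia. Qed.

Lemma part_sum_rcons l b : part_sum (rcons l b) = (b.+1 + part_sum l)%N.
Proof.
by rewrite /part_sum -cats1 size_cat count_cat; case: b => /=; lia.
Qed.

Lemma part_sum_take i l : (part_sum (take i l) <= part_sum l)%N.
Proof.
rewrite -[in leqRHS](cat_take_drop i l) /part_sum size_cat count_cat; lia.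
Qed.

Lemma leq_size_part_sum l : (size l <= part_sum l)%N.
Proof. exact: leq_addr. Qed.

Lemma count_size_bool (w : seq bool) :
  (count_mem true w + count_mem false w = size w)%N.
Proof. by elim: w => //= -[] w; lia. Qed.

Lemma size_rev_path l m : size (rev_path l m) = (size l + part_sum l + m)%N.
Proof.
rewrite /rev_path size_cat size_nseq; congr addn.
elim: l => // b l IH /=; rewrite part_sum_cons !size_cat /= size_nseq IH /U; lia.
Qed.

Lemma count_rev_path l m : count_mem U (rev_path l m) = (size l + m)%N.
Proof.
rewrite /rev_path count_cat count_nseq /= mul1n; congr addn.
elim: l => // b l IH /=; rewrite !count_cat /= count_nseq IH /U /=; lia.
Qed.

(* Counting up steps is adjoint to locating them: read from the right, the
   [i]-th up step sits at distance [i + part_sum (take i l)]. *)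
Lemma leq_count_rev_path l m i j : (i <= size l + m)%N ->
  (i <= count_mem U (take j (rev_path l m)))%N = (i + part_sum (take i l) <= j)%N.
Proof.
elim: l i j => [|b l IH] i j.
  rewrite /rev_path /= => im; case: (leqP m j) => jm.
    by rewrite take_oversize ?size_nseq // count_nseq /=; rewrite /part_sum /=; lia.
  by rewrite take_nseq ?count_nseq /= /part_sum /=; lia.
case: i => [|i]; first by rewrite /part_sum.
rewrite /= addSn ltnS => im; rewrite part_sum_cons.
have -> : rev_path (b :: l) m = nseq b.+1 D ++ U :: rev_path l m.
  by rewrite /rev_path -catA.
rewrite take_cat size_nseq; case: (ltnP j) => jb.
  rewrite take_nseq ?count_nseq /=; last by lia.
  lia.
rewrite count_cat count_nseq /=.
case E: (j - b.+1)%N => [|j'] /=; first by lia.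
by rewrite add1n ltnS IH //; lia.
Qed.

(** The reversed word decodes uniquely: a block opens with [D], and its second letter tells one down
    step from two. The final runs of up steps are generalised, since the number of parts 2 changes
    along the induction. *)
Lemma path_of_inj : injective path_of.
Proof.
move=> l l' /(can_inj revK); rewrite /rev_path.
move: (count_mem true l) (count_mem true l') => m m'.
elim: l l' m m' => [|b l IH] [|b' l'] m m' //=.
- by case: m => [|m].
- by case: m' => [|m'].
rewrite -!catA /=; case: b b' => [] [] //= [].
- by move/IH => ->.
- by move/IH => ->.
Qed.

Lemma size_path_of l : size (path_of l) = (part_sum l).*2.
Proof. by rewrite size_rev size_rev_path /part_sum; lia. Qed.

Lemma count_take_path_of l j :
  let n := part_sum l in let v := rev_path l (count_mem true l) in
  count_mem U (take (n.*2 - j) (path_of l)) = (n - count_mem U (take j v))%N.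
Proof.
move=> n v; rewrite /path_of -/v take_rev.
have sv : size v = n.*2 by rewrite -size_rev size_path_of.
rewrite count_rev sv.
have cv : count_mem U v = n by rewrite count_rev_path.
case: (leqP j n.*2) => jn; last first.
  rewrite take_oversize ?sv; last exact: ltnW.
  by rewrite cv drop_oversize ?sv /=; lia.
rewrite -[in X in (_ = X - _)%N]cv -{2}(cat_take_drop j v) count_cat subKn //.
lia.
Qed.

Lemma count_take_leq_size l j :
  (count_mem U (take j (rev_path l (count_mem true l))) <= part_sum l)%N.
Proof.
rewrite -[leqRHS](count_rev_path l (count_mem true l)).
by rewrite -{2}(cat_take_drop j (rev_path l _)) count_cat leq_addr.
Qed.

(** Up and down steps are equally many, so the height at distance [j] from the right end can be read
    off the last [j] steps. *)
Lemma height_path_of l j : let n := part_sum l in (j <= n.*2)%N ->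
  height (path_of l) (n.*2 - j) =
  j%:Z - ((count_mem U (take j (rev_path l (count_mem true l)))).*2)%:Z.
Proof.
move=> n jn; rewrite /height.
set w := take _ _.
have := count_size_bool w.
have -> : count_mem true w =
    (n - count_mem U (take j (rev_path l (count_mem true l))))%N.
  exact: count_take_path_of.
have -> : size w = (n.*2 - j)%N by rewrite size_takel // size_path_of leq_subr.
have := count_take_leq_size l j.
rewrite /U /D; lia.
Qed.

Lemma part_sum_take_geq l i : (i <= part_sum l)%N -> (i <= part_sum (take i l))%N.
Proof.
move=> il; case: (leqP i (size l)) => isz; last first.
  by rewrite take_oversize // ltnW.
by rewrite -{1}(size_takel isz) leq_size_part_sum.
Qed.

Lemma dyck_path_of l : dyck (path_of l).
Proof.
set n := part_sum l.
have h i : (i <= n.*2)%N -> 0 <= height (path_of l) i.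
  move=> iN; rewrite -(subKn iN) height_path_of ?leq_subr //.
  set j := (_ - i)%N; set c := count_mem _ _.
  have cn : (c <= n)%N by exact: count_take_leq_size.
  (* With [c] up steps among the last [j], the adjunction gives [c + part_sum (take c l) <= j];
     parts are at least 1, whence [2 c <= j]. *)
  have := @leq_count_rev_path l (count_mem true l) c j cn.
  rewrite leqnn => /esym; have := part_sum_take_geq cn; lia.
apply/andP; split.
  by apply/forallP => i; apply: h; rewrite -ltnS -size_path_of.
rewrite size_path_of -[X in height _ X]subn0 height_path_of // take0 /=; lia.
Qed.

Lemma avoids_path_of l :
  avoids [:: D; U; U] (path_of l) && avoids [:: D; D; D] (path_of l).
Proof.
rewrite /avoids /path_of -(infix_rev [:: D; U; U]) -(infix_rev [:: D; D; D]) revK.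
rewrite /rev /=.
(* The added [U] stands for the up step closing the preceding block, so that the induction also sees
   factors straddling two blocks. *)
suff /andP[h1 h2] : ~~ infix [:: U; U; D] (U :: rev_path l (count_mem true l)) &&
          ~~ infix [:: D; D; D] (U :: rev_path l (count_mem true l)).
  by move: h1 h2; rewrite !(infix_consl _ U) !negb_or => /andP[_ ->] /andP[_ ->].
move: (count_mem _ _) => m; rewrite /rev_path; elim: l => [|[] l] /=.
- by elim: m => //= -[|[|m]].
- by case: (rev_blocks l ++ _) => [|[] [|[] s]] //=.
- by case: (rev_blocks l ++ _) => [|[] [|[] s]] //=.
Qed.

(** Blocks are split off one at a time. Two adjacent up steps cannot be followed by [D], so only up
    steps remain after them; the condition on the last letter excludes an unfinished block. *)
Lemma rev_path_surj v : ~~ infix [:: U; U; D] (U :: v) ->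
  ~~ infix [:: D; D; D] v -> last U v = U -> exists l m, v = rev_path l m.
Proof.
have [k] := ubnP (size v); elim: k v => // k IH [|[] v] /=.
- by exists [::], 0%N.
- rewrite ltnS => sv /norP[h1 h2] h3 hl.
  have [||//|l [m vE]] := IH v sv; [exact: h2|exact: h3|].
  have l0 : l = [::] by move: h1; rewrite vE; case: (l) => // -[].
  by exists [::], m.+1; rewrite vE l0.
- case: v => [|[] v] //=.
    move=> sv h1 h2 hl.
    have [|//|//|//|l [m vE]] := IH v; first by lia.
    by exists (false :: l), m; rewrite vE.
  case: v => [|[] v] //= sv h1 h2 hl; last by move: h2; rewrite prefix0s.
  have [|//|//|//|l [m vE]] := IH v; first by lia.
    by exists (true :: l), m; rewrite vE.
Qed.

Lemma mem_F2 n (w : (n.*2).-tuple bool) :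
  w \in F2 n -> exists2 l, part_sum l = n & tval w = path_of l.
Proof.
rewrite inE => /and3P[/andP[/forallP hpos /eqP hend]].
rewrite /avoids -(infix_rev [:: D; U; U]) -(infix_rev [:: D; D; D]) /rev /= -/(rev w).
move=> h1 h2.
have sw := size_tuple w.
have [|//||l [m vE]] := @rev_path_surj (rev w).
(* A path ending with an up step would be at height -1 just before it. *)
- case E : (rev w) h1 => [|[] v] //= h1; exfalso.
  have wE : tval w = rcons (rev v) U by rewrite -[tval w]revK E rev_cons.
  have vs : (size v < (size w).+1)%N by rewrite wE size_rcons size_rev; lia.
  have := hpos (Ordinal vs); move: hend; rewrite /height take_size /= wE.
  rewrite -[in take (size v)](size_rev v) -cats1 take_size_cat // !count_cat /=.
  by move: (count_mem U (rev v)) (count_mem D (rev v)) => a b; lia.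
- case E : (tval w) hpos => [|a w'] hpos //.
  rewrite rev_cons last_rcons; case: a E hpos => // E hpos; exfalso.
  have := hpos (Ordinal (isT : (1 < (size (false :: w')).+1)%N)).
  by rewrite /height /= take0.
have wE : tval w = rev (rev_path l m) by rewrite -vE revK.
have cU : count_mem U w = (size l + m)%N by rewrite wE count_rev count_rev_path.
have sE : (n.*2 = size l + part_sum l + m)%N by rewrite -sw wE size_rev size_rev_path.
(* Half of the steps are up steps, because the path ends at height 0; this forces the length [m] of
   the extra run. *)
have mE : m = count_mem true l.
  move: hend cU; rewrite /height take_size /U /D => hend cU.
  move: hend (count_size_bool w) sE; rewrite sw cU /part_sum; lia.
exists l; last by rewrite wE mE.
by move: sE; rewrite mE /part_sum; lia.
Qed.

(** * The Stanley order as domination of partial sums *)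

Definition dominated (p q : seq bool) : Prop :=
  forall i, (part_sum (take i p) <= part_sum (take i q))%N.

(** The path [P] is below [Q] when every suffix of [P] has at least as many up steps as the suffix
    of [Q] of the same length. Passing to the adjoints of these counts reverses the comparison and
    leaves the partial sums. *)
Lemma stanley_path_of n (P Q : (n.*2).-tuple bool) p q :
    part_sum p = n -> part_sum q = n ->
    tval P = path_of p -> tval Q = path_of q ->
  stanley P Q <-> dominated p q.
Proof.
move=> pn qn PE QE.
pose u l j := count_mem U (take j (rev_path l (count_mem true l))).
have uP l i j : part_sum l = n -> (i <= n)%N ->
    (i <= u l j)%N = (i + part_sum (take i l) <= j)%N.
  by move=> ln iN; rewrite leq_count_rev_path // -/(part_sum l) ln.
have hE l j : part_sum l = n -> (j <= n.*2)%N ->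
    height (path_of l) (n.*2 - j) = j%:Z - (u l j).*2%:Z.
  by move=> ln jn; have := @height_path_of l j; rewrite /= ln => ->.
split.
  move=> /forallP PQ i; case: (leqP i n) => iN; last first.
    rewrite !take_oversize ?pn ?qn //; apply: ltnW; apply: leq_ltn_trans iN.
      by rewrite -qn leq_size_part_sum.
    by rewrite -pn leq_size_part_sum.
  (* The length [jj] is that of the shortest suffix of [Q] with [i] up steps. *)
  set k := part_sum (take i q); pose jj := (i + k)%N.
  have jn : (jj <= n.*2)%N.
    by have := part_sum_take i q; rewrite qn /jj /k; lia.
  have jO : (n.*2 - jj < n.*2.+1)%N by rewrite ltnS leq_subr.
  have := PQ (Ordinal jO); rewrite /= PE QE !hE // => uu.
  have : (i <= u q jj)%N by rewrite uP.
  move=> iq; have : (i <= u p jj)%N by apply: leq_trans iq _; move: uu; lia.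
  by rewrite uP // leq_add2l.
move=> pq; apply/forallP => -[i /=]; rewrite ltnS => iN.
rewrite PE QE -(subKn iN) !hE ?leq_subr //.
set jj := (_ - i)%N.
suff : (u q jj <= u p jj)%N by lia.
have qq : (u q jj <= n)%N by rewrite -qn count_take_leq_size.
rewrite uP //; have := leqnn (u q jj); rewrite [in X in X -> _]uP //.
by apply: leq_trans; rewrite leq_add2l.
Qed.

(** The up step of the first block, if there is one, prolongs the initial run. *)
Lemma first_ascent_path_of l :
  first_ascent (path_of l) = (count_mem true l + (l != [::]))%N.
Proof.
rewrite /first_ascent /path_of /rev_path rev_cat rev_nseq.
have idx m s : index D (nseq m U ++ s) = (m + index D s)%N by elim: m => //= m ->.
rewrite idx; congr addn; case: (lastP l) => // s b.
have -> : rev_blocks (rcons s b) = rev_blocks s ++ rcons (nseq b.+1 D) U.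
  by elim: s => [|a s IH] /=; [rewrite -cats1|rewrite IH -catA].
by rewrite rev_cat rev_rcons rev_nseq /=; case: s.
Qed.

(** The first [size p] parts of [q] already reach the common total, and further parts would be
    positive. *)
Lemma dominated_size p q : part_sum p = part_sum q -> dominated p q ->
  (size q <= size p)%N.
Proof.
move=> pq /(_ (size p)); rewrite take_size pq leqNgt; apply: contraNleq => sp.
rewrite -{2}(cat_take_drop (size p) q) /part_sum size_cat count_cat.
by rewrite size_drop; lia.
Qed.

(** The number of parts 2 is [n] minus the number of parts, and the correction for the empty
    composition is the same on both sides. *)
Lemma first_ascent_diff n k p q : part_sum p = n -> part_sum q = n ->
  ((first_ascent (path_of q))%:Z - (first_ascent (path_of p))%:Z == k%:Z)
  = (size p == size q + k)%N.
Proof.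
move=> pn qn; rewrite !first_ascent_path_of.
have nil l : part_sum l = n -> (l != [::]) = (n != 0%N).
  by move=> <-; case: l => // b l; rewrite part_sum_cons.
rewrite !nil //; move: pn qn; rewrite /part_sum; lia.
Qed.

Lemma count_take_inj (w w' : seq bool) : size w = size w' ->
  (forall i, (i <= size w)%N ->
     count_mem true (take i w) = count_mem true (take i w')) -> w = w'.
Proof.
move=> sw h; apply: (@eq_from_nth _ true) => // i iw.
have := h i.+1 iw; rewrite !(take_nth true) -?sw // -!cats1 !count_cat h ?(ltnW iw) //=.
by move/addnI; case: (nth _ _ _) (nth _ _ _) => -[].
Qed.

(** * Intervals as pairs of compositions *)

Lemma stanley_refl n (P : (n.*2).-tuple bool) : stanley P P.
Proof. exact/forallP. Qed.

Lemma stanley_anti n (P Q : (n.*2).-tuple bool) :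
  stanley P Q -> stanley Q P -> P = Q.
Proof.
move=> /forallP PQ /forallP QP; apply: val_inj; apply: count_take_inj.
  by rewrite !size_tuple.
move=> i; rewrite size_tuple => iN.
have io : (i < n.*2.+1)%N by [].
have := PQ (Ordinal io); have := QP (Ordinal io); rewrite /height /=.
have := count_size_bool (take i P); have := count_size_bool (take i Q).
rewrite !size_takel ?size_tuple // /U /D.
move: (count_mem true _) (count_mem true (take i P)).
by move: (count_mem false _) (count_mem false _) => a b c e; lia.
Qed.

(** Intervals are counted as sets; the end points belong to the interval as its least and greatest
    elements, so they can be recovered from it. *)
Lemma stanley_interval_inj n (P Q P' Q' : (n.*2).-tuple bool) :
    P \in F2 n -> Q \in F2 n -> P' \in F2 n -> Q' \in F2 n ->
    stanley P Q -> stanley P' Q' ->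
  stanley_interval P Q = stanley_interval P' Q' -> (P, Q) = (P', Q').
Proof.
move=> PF QF PF' QF' PQ PQ' /setP E.
have := E P; have := E Q; have := E P'; have := E Q'.
rewrite !inE.
rewrite inE in PF; rewrite inE in QF; rewrite inE in PF'; rewrite inE in QF'.
rewrite PF QF PF' QF' !stanley_refl PQ PQ' /= => /andP[_ h1] /andP[h2 _].
move=> /esym/andP[_ h3] /esym/andP[h4 _].
by congr pair; apply: stanley_anti.
Qed.

Definition path_pairs n (c : rel ((n.*2).-tuple bool)) :
    {set (n.*2).-tuple bool * (n.*2).-tuple bool} :=
  [set u | [&& u.1 \in F2 n, u.2 \in F2 n & stanley u.1 u.2 && c u.1 u.2]].

Lemma card_stanley_intervals n (c : rel ((n.*2).-tuple bool)) :
  #|[set stanley_interval P Q | P in F2 n, Q in F2 n & stanley P Q && c P Q]%SET|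
  = #|path_pairs c|.
Proof.
rewrite -(@card_in_imset _ _ (fun u => stanley_interval u.1 u.2) (path_pairs c)).
  apply: eq_card => I; apply/imset2P/imsetP => [[P Q PF]|[[P Q]]].
    rewrite inE => /andP[QF PQ] ->; exists (P, Q) => //.
    by rewrite inE /= PF QF PQ.
  rewrite inE /= => /and3P[PF QF PQ] ->; exists P Q => //.
  by rewrite inE QF PQ.
move=> [P Q] [P' Q']; rewrite !inE /= => /and3P[PF QF /andP[PQ _]].
move=> /and3P[PF' QF' /andP[PQ' _]].
by apply: stanley_interval_inj; rewrite ?inE.
Qed.

(* The pairs [(q, p)] encoding the pairs [P <= Q] when [d = 0]; for [d > 0],
   the left ends of such pairs with [p] still missing parts of total [d]. *)
Definition dominated_pair (n k d : nat) (t : seq bool * seq bool) : Prop :=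
  [/\ part_sum t.1 = n, size t.2 = (size t.1 + k)%N,
      (part_sum t.2 + d)%N = n & dominated t.2 t.1].

Lemma card_path_pairs n k (s : seq (seq bool * seq bool)) :
    uniq s -> (forall t, t \in s <-> dominated_pair n k 0 t) ->
  j n k = size s.
Proof.
move=> us sP.
rewrite /j /intervals_ascent (@card_stanley_intervals n
  (fun P Q => (first_ascent Q)%:Z - (first_ascent P)%:Z == k%:Z)).
set A := path_pairs _.
pose f (u : (n.*2).-tuple bool * (n.*2).-tuple bool) := (tval u.2, tval u.1).
pose g (t : seq bool * seq bool) := (path_of t.1, path_of t.2).
rewrite cardE -(size_map f) -[RHS](size_map g); apply/perm_size/uniq_perm.
- rewrite map_inj_uniq ?enum_uniq // => -[P Q] [P' Q'] [/val_inj -> /val_inj ->] //.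
- by rewrite map_inj_uniq // => -[a b] [a' b'] [/path_of_inj -> /path_of_inj ->].
move=> z; apply/mapP/mapP.
- move=> [[P Q]]; rewrite mem_enum inE /= => /and3P[PF QF /andP[PQ]].
  have [p pn pE] := mem_F2 PF; have [q qn qE] := mem_F2 QF.
  rewrite pE qE (first_ascent_diff _ pn qn) => /eqP spq ->.
  exists (q, p); last by rewrite /g /f /= pE qE.
  by apply/sP; split => //=; [rewrite addn0|apply/(stanley_path_of pn qn pE qE)].
- move=> [[q p]] /sP[/= qn spq]; rewrite addn0 => pn pq ->.
  have sT l : part_sum l = n -> size (path_of l) == n.*2.
    by move=> ln; rewrite size_path_of ln.
  have inF l (ln : part_sum l = n) : Tuple (sT l ln) \in F2 n.
    by rewrite inE /= dyck_path_of avoids_path_of.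
  exists (Tuple (sT p pn), Tuple (sT q qn)) => //.
  rewrite mem_enum inE /= !inF /= (first_ascent_diff _ pn qn) spq eqxx andbT.
  by apply/(stanley_path_of pn qn).
Qed.

Lemma card_intervals n : #|intervals n| = (\sum_(k < n.+1) j n k)%N.
Proof.
have -> : #|intervals n| = #|path_pairs (fun P Q : (n.*2).-tuple bool => true)|.
  rewrite -card_stanley_intervals; apply: eq_card => I.
  by apply/imset2P/imset2P => -[P Q PF]; rewrite inE ?andbT => QF ->;
    exists P Q => //; rewrite inE ?andbT.
(* The subtraction is not truncated, since by [dominated_size] the upper path has the longer first
   ascent, and [inord] is exact since a first ascent is at most [n]. *)
pose key (u : (n.*2).-tuple bool * (n.*2).-tuple bool) : 'I_n.+1 :=
  inord (first_ascent u.2 - first_ascent u.1).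
rewrite -sum1_card (partition_big key predT) //=; apply: eq_bigr => k _.
rewrite /j /intervals_ascent (@card_stanley_intervals n
  (fun P Q => (first_ascent Q)%:Z - (first_ascent P)%:Z == k%:Z)).
rewrite -sum1_card; apply: eq_bigl => -[P Q]; rewrite !inE /= andbT.
case PF : [&& dyck P, _ & _] => //=; case QF : [&& dyck Q, _ & _] => //=.
case PQ : (stanley P Q) => //=.
have [|p pn pE] := @mem_F2 n P; first by rewrite inE.
have [|q qn qE] := @mem_F2 n Q; first by rewrite inE.
have /(stanley_path_of pn qn pE qE)/dominated_size spq := PQ.
rewrite -val_eqE /= inordK.
  have := spq; rewrite pn qn => /(_ erefl); rewrite pE qE.
  rewrite (first_ascent_diff _ pn qn) !first_ascent_path_of.
  have nil l : part_sum l = n -> (l != [::]) = (n != 0%N).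
    by move=> <-; case: l => // b l; rewrite part_sum_cons.
  by rewrite !nil //; move: pn qn; rewrite /part_sum; lia.
rewrite ltnS; apply: leq_trans (leq_subr _ _) _.
rewrite qE first_ascent_path_of -qn.
by case: (q) => // b l; rewrite part_sum_cons /part_sum; case: b => /=; lia.
Qed.

(** * Generating functions *)

Section Series.
Variable R : comNzRingType.
Implicit Types (a b c : {fps R}) (n : nat).

Lemma fps_coefD a b n : (a + b) n = a n + b n. Proof. by []. Qed.
Lemma fps_coefN a n : (- a) n = - a n. Proof. by []. Qed.
Lemma fps_coefM a b n : (a * b) n = \sum_(i < n.+1) a i * b (n - i)%N.
Proof. by []. Qed.
Lemma fps_coef1 n : (1 : {fps R}) n = (n == 0%N)%:R.
Proof. by case: n. Qed.

Lemma fps_coefXM a n : (fps_X R * a) n = if n is m.+1 then a m else 0.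
Proof.
rewrite fps_coefM; case: n => [|n]; first by rewrite big_ord1 mul0r.
rewrite big_ord_recl mul0r add0r big_ord_recl /= mul1r subSS subn0 big1 ?addr0 //.
by move=> i _; rewrite mul0r.
Qed.

Lemma fps_coefMn a m n : (a *+ m) n = a n *+ m.
Proof. by elim: m => // m IH; rewrite !mulrS fps_coefD IH. Qed.

Lemma fps_eqM a a' b b' n :
  (forall i, (i <= n)%N -> a i = a' i) -> (forall i, (i <= n)%N -> b i = b' i) ->
  (a * b) n = (a' * b') n.
Proof.
move=> ea eb; rewrite !fps_coefM; apply: eq_bigr => -[i /=]; rewrite ltnS => iN _.
by rewrite ea // eb // leq_subr.
Qed.

(** Such a map is contracting: iterated from 0, it no longer changes the coefficient [n] from the
    iterate [n + 1] on. *)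
Lemma fps_fixpoint (Phi : {fps R} -> {fps R}) :
    (forall a b n, (forall i, (i < n)%N -> a i = b i) -> Phi a n = Phi b n) ->
  exists a, Phi a = a.
Proof.
move=> Phi_contr; pose it m := iter m Phi 0.
have itS m n : (n < m)%N -> it m.+1 n = it m n.
  elim: m n => // m IH n; rewrite ltnS => nm.
  by apply: Phi_contr => i im; apply: IH; apply: leq_trans nm.
have itD m n : (n < m)%N -> it m n = it n.+1 n.
  elim: m => // m IH; rewrite ltnS leq_eqVlt => /predU1P[-> //|nm].
  by rewrite itS // IH.
exists (Fps (fun n => it n.+1 n)); apply/fpsP => n /=.
by apply: Phi_contr => i im /=; rewrite itD.
Qed.

(* The generating function of Motzkin paths whose level, up and down steps have
   weights [x + x^2], [x^2] and [x]. *)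
Lemma motzkin_series : exists M : {fps R},
  M = 1 + (fps_X R + fps_X R ^+ 2) * M + fps_X R ^+ 3 * M ^+ 2.
Proof.
set x := fps_X R.
have [|M ME] := @fps_fixpoint (fun M => 1 + x * (M + x * M + x * (x * (M * M)))).
  move=> a b [|n] ab; rewrite !fps_coefD !fps_coefXM //.
  congr (_ + _); rewrite !fps_coefD !fps_coefXM ab //; congr (_ + _ + _).
    by case: n ab => // n ab; rewrite ab.
  case: n ab => // n ab; rewrite !fps_coefXM; case: n ab => // n ab.
  by apply: fps_eqM => i iN; apply: ab; rewrite ltnS; apply: leq_trans iN _; lia.
by exists M; rewrite -[LHS]ME; ring.
Qed.

Lemma fps_coef_Xpow_small m a n : (n < m)%N -> (fps_X R ^+ m * a) n = 0.
Proof.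
elim: m n => // m IH n nm; rewrite exprS -mulrA fps_coefXM.
by case: n nm => // n nm; rewrite IH.
Qed.

End Series.

(** * Recurrences for Motzkin prefixes *)

Section Motzkin.
Variables (R : comNzRingType) (M : {fps R}).
Let x := fps_X R.
Hypothesis ME : M = 1 + (x + x ^+ 2) * M + x ^+ 3 * M ^+ 2.
(** [T] is an up step that is never undone, with the Motzkin path that follows it. An extra part of
    [P] uses up one or two such levels, which gives [W]. *)
Let T := x ^+ 2 * M.
Let W := T + T ^+ 2.

Lemma level_recurrence0 : M = 1 + x * (M + x * M + M * T).
Proof. by rewrite {1}ME /T; ring. Qed.

(** Decomposition by the last step: two kinds of level step, an up step from level [d], a down step
    from level [d + 2]. The two sides differ by a multiple of the equation of [M]. *)
Lemma level_recurrence d : M * T ^+ d.+1 =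
  x * (M * T ^+ d.+1 + x * (M * T ^+ d.+1) + x * (M * T ^+ d) + M * T ^+ d.+2).
Proof.
rewrite !exprSr; set a := _ ^+ d.
apply/eqP; rewrite -subr_eq0.
have := subrr M; rewrite [in X in _ - X]ME => M0.
rewrite (_ : _ - _ = x ^+ 2 * M * a * (M - (1 + (x + x ^+ 2) * M + x ^+ 3 * M ^+ 2))).
  by rewrite M0 mulr0.
by rewrite /T; ring.
Qed.

Lemma level_coef d n : (M * T ^+ d) n =
  ((n == 0%N) && (d == 0%N))%:R +
  (if (0 < n)%N then (M * T ^+ d) (n - 1)%N + (M * T ^+ d.+1) (n - 1)%N else 0) +
  (if (1 < n)%N then (M * T ^+ d) (n - 2)%N +
    (if d is d'.+1 then (M * T ^+ d') (n - 2)%N else 0) else 0).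
Proof.
case: d => [|d].
  rewrite expr0 mulr1 expr1 {1}level_recurrence0 fps_coefD fps_coef1 andbT fps_coefXM.
  case: n => [|n]; first by rewrite !addr0.
  rewrite !fps_coefD fps_coefXM subn1 /=; case: n => [|n].
    by rewrite /= addr0 !addr0.
  by rewrite subn2 /= !addr0 !add0r addrAC.
rewrite {1}level_recurrence fps_coefXM andbF.
move: (M * T ^+ d.+1) (M * T ^+ d) (M * T ^+ d.+2) => a b c.
case: n => [|n]; first by rewrite !addr0.
rewrite !fps_coefD !fps_coefXM subn1 /= add0r.
by case: n => [|n]; rewrite ?subn2 /=; ring.
Qed.

(** Series counterpart of removing the last extra part, 1 or 2, which is then added to the missing
    total [d]. *)
Lemma extra_part_recurrence d k : M * T ^+ d * W ^+ k.+1 =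
  M * T ^+ d.+1 * W ^+ k + M * T ^+ d.+2 * W ^+ k.
Proof. by rewrite /W !exprSr; ring. Qed.

End Motzkin.

(** * Enumeration of dominated pairs by their last parts *)

Lemma dominated_rcons p q a b :
    (part_sum (rcons p b) <= part_sum (rcons q a))%N ->
    size p = size q ->
  dominated (rcons p b) (rcons q a) <-> dominated p q.
Proof.
move=> le_last spq; split => h i.
  have := h (minn i (size p)); rewrite -!cats1 !takel_cat ?geq_minr ?spq ?geq_minr //.
  case: (leqP i (size q)) => [//|iq].
  by rewrite !take_oversize -?spq //; apply: ltnW; rewrite ?spq.
have := h i; case: (leqP i (size p)) => ip.
  by rewrite -!cats1 !takel_cat // -spq.
by rewrite !(@take_oversize _ i (rcons _ _)) ?size_rcons -?spq.
Qed.

Lemma dominated_rconsl p q b : (part_sum (rcons p b) <= part_sum q)%N ->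
    (size q <= size p)%N ->
  dominated (rcons p b) q <-> dominated p q.
Proof.
move=> le_last sqp; split => h i.
  have := h (minn i (size p)); rewrite -cats1 takel_cat ?geq_minr //.
  case: (leqP i (size p)) => [//|ip].
  by rewrite !take_oversize // ltnW // (leq_ltn_trans sqp).
have := h i; case: (leqP i (size p)) => ip.
  by rewrite -cats1 takel_cat.
by rewrite !take_oversize ?size_rcons // ltnW // (leq_ltn_trans sqp).
Qed.

Lemma dominated_pair_rconsr n k d q p b :
  dominated_pair n k.+1 d (q, rcons p b) <-> dominated_pair n k (d + b.+1) (q, p).
Proof.
rewrite /dominated_pair /= size_rcons part_sum_rcons.
have iffE : part_sum q = n -> (b.+1 + part_sum p + d = n)%N ->
    size p = (size q + k)%N -> dominated (rcons p b) q <-> dominated p q.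
  by move=> qn pn sp; apply: dominated_rconsl; rewrite ?part_sum_rcons; lia.
by split=> -[qn sp pn dom]; have [|||h1 h2] := iffE; try lia; split; try lia; auto.
Qed.

(** Removing both last parts undoes one Motzkin step, from level [d + b - a] to level [d]; the bound
    on [a] keeps the earlier level nonnegative. *)
Lemma dominated_pair_rcons2 n d q p a b :
  dominated_pair n 0 d (rcons q a, rcons p b) <->
  [/\ (a < n)%N, (a <= d + b)%N & dominated_pair (n - a.+1) 0 (d + b - a) (q, p)].
Proof.
rewrite /dominated_pair /= !size_rcons !part_sum_rcons !addn0.
have iffE : (part_sum (rcons p b) <= part_sum (rcons q a))%N -> size p = size q ->
    dominated (rcons p b) (rcons q a) <-> dominated p q.
  exact: dominated_rcons.
rewrite !part_sum_rcons in iffE.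
split=> [[qn [sp] pn dom]|[an ad [qn sp pn dom]]].
  have [||h1 _] := iffE; try lia.
  have dom' := h1 dom.
  have := dom' (size p); rewrite take_size sp take_size => pq.
  by split; try lia; split => //; lia.
by have [||_ h2] := iffE; try lia; split; try lia; auto.
Qed.

Lemma dominated_pair_nil n d p :
  dominated_pair n 0 d ([::], p) <-> [/\ n = 0%N, d = 0%N & p = [::]].
Proof.
rewrite /dominated_pair /=; split=> [[<- sp pn _]|[-> -> ->]].
  by move: sp pn; rewrite addn0 => /size0nil -> /=; rewrite add0n.
by split.
Qed.

Section Enumeration.
Variables (R : comNzRingType) (M : {fps R}).
Let x := fps_X R.
Hypothesis ME : M = 1 + (x + x ^+ 2) * M + x ^+ 3 * M ^+ 2.
Let T := x ^+ 2 * M.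
Let W := T + T ^+ 2.

(** Pairs of lists form an infinite type, so they are counted by a list without repetition. The
    count is taken in [R], where it meets the coefficients of the series. *)
Let enumerates n k d (s : seq (seq bool * seq bool)) :=
  [/\ uniq s, forall t, t \in s <-> dominated_pair n k d t
    & (size s)%:R = (M * T ^+ d * W ^+ k) n :> R].

(** The outer induction on [k] removes the last part of the longer composition; for [k = 0], a
    strong induction on [n] removes the last parts of both. *)
Lemma dominated_pairs_enum n k d : exists s, enumerates n k d s.
Proof.
elim: k n d => [|k IH] n d; last first.
  have [s1 [u1 m1 c1]] := IH n d.+1; have [s2 [u2 m2 c2]] := IH n d.+2.
  pose f b (t : seq bool * seq bool) := (t.1, rcons t.2 b).
  have f_inj b : injective (f b).
    by move=> [q p] [q' p'] [-> /rcons_inj [->]].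
  exists (map (f false) s1 ++ map (f true) s2); split.
  - rewrite cat_uniq !map_inj_uniq // u1 u2 andbT /=.
    apply/hasPn => _ /mapP[t _ ->]; apply/mapP => -[t' _ []] _.
    by move=> /(congr1 (last true)); rewrite !last_rcons.
  - move=> [q p]; rewrite mem_cat; split.
      case/orP => /mapP[[q' p'] + [-> ->]].
        by move/m1 => h; apply/dominated_pair_rconsr; rewrite addn1.
      by move/m2 => h; apply/dominated_pair_rconsr; rewrite addn2.
    case: (lastP p) => [|p' b]; first by case=> /= _; rewrite addnS.
    move/dominated_pair_rconsr; case: b; rewrite ?addn1 ?addn2 => h; apply/orP.
      by right; apply/mapP; exists (q, p') => //; apply/m2.
    by left; apply/mapP; exists (q, p') => //; apply/m1.
  - rewrite size_cat !size_map natrD c1 c2.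
    by rewrite -fps_coefD -extra_part_recurrence.
have [m] := ubnP n; elim: m n d => // m IHm n d; rewrite ltnS => nm.
pose f a b (t : seq bool * seq bool) := (rcons t.1 a, rcons t.2 b).
have f_inj a b : injective (f a b).
  by move=> [q p] [q' p'] [/rcons_inj [->] /rcons_inj [->]].
have ex a b : exists s, [/\ uniq s,
    forall q p, (q, p) \in s <-> dominated_pair n 0 d (rcons q a, rcons p b)
  & (size s)%:R = if (a < n)%N && (a <= d + b)%N
        then (M * T ^+ (d + b - a)) (n - a.+1)%N else 0 :> R].
  case: ifP => [/andP[an ad]|h]; last first.
    exists [::]; split=> // q p; split=> // /dominated_pair_rcons2[h1 h2].
    by rewrite h1 h2 in h.
  have [|s [us ms cs]] := IHm (n - a.+1)%N (d + b - a)%N; first by lia.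
  exists s; split => // [q p|]; last by rewrite cs expr0 mulr1.
  by split=> [/ms h|/dominated_pair_rcons2[_ _ /ms]//]; apply/dominated_pair_rcons2.
have [s00 [u00 m00 c00]] := ex false false; have [s01 [u01 m01 c01]] := ex false true.
have [s10 [u10 m10 c10]] := ex true false; have [s11 [u11 m11 c11]] := ex true true.
(* The pair of empty compositions, with the condition [n = d = 0] as its multiplicity 0 or 1. *)
pose s0 : seq (seq bool * seq bool) := nseq ((n == 0%N) && (d == 0%N)) ([::], [::]).
exists (s0 ++ map (f false false) s00 ++ map (f false true) s01 ++
        map (f true false) s10 ++ map (f true true) s11); split.
- have disj a b a' b' s s' : (a, b) != (a', b') ->
    has [in map (f a b) s] (map (f a' b') s') = false.
    move=> /eqP ab; apply/hasP => -[_ /mapP[t _ ->] /mapP[t' _ []]].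
    by move=> /rcons_inj[_ ea] /rcons_inj[_ eb]; rewrite ea eb in ab.
  have disj0 a b s : has [in s0] (map (f a b) s) = false.
    apply/hasP => -[_ /mapP[[[|c q] p] _ ->]];
    by rewrite /s0 mem_nseq => /andP[_ /eqP].
  rewrite !cat_uniq !has_cat !disj0 !disj // !map_inj_uniq // u00 u01 u10 u11.
  by rewrite /= andbT /s0; case: ((n == 0%N) && (d == 0%N)).
- move=> [q p]; rewrite !mem_cat /s0 mem_nseq; split.
    case/or4P => [/andP[+ /eqP[-> ->]]|/mapP[[q' p'] /m00 h [-> ->]]|
      /mapP[[q' p'] /m01 h [-> ->]]|/orP[/mapP[[q' p'] /m10 h [-> ->]]|
      /mapP[[q' p'] /m11 h [-> ->]]]] //.
    by rewrite lt0b => /andP[/eqP -> /eqP ->]; apply/dominated_pair_nil.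
  case: (lastP q) => [|q' a].
    by move/dominated_pair_nil=> [-> -> ->]; rewrite !eqxx.
  case: (lastP p) => [|p' b].
    by case=> /= _; rewrite size_rcons.
  by case: a b => [] [] h; apply/or4P;
    [apply: Or44; apply/orP; right|apply: Or44; apply/orP; left
    |apply: Or43|apply: Or42]; apply/mapP; exists (q', p') => //;
    [apply/m11|apply/m10|apply/m01|apply/m00].
- rewrite !size_cat !size_map size_nseq !natrD c00 c01 c10 c11 expr0 mulr1.
  rewrite [in RHS]level_coef // !addn0 !subn0 !andbT addn1 subSS subn0.
  clear s0 s00 u00 m00 c00 s01 u01 m01 c01 s10 u10 m10 c10 s11 u11 m11 c11 ex.
  pose a e := M * T ^+ e.
  rewrite -[M * T ^+ d]/(a d) -[M * T ^+ d.+1]/(a d.+1).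
  rewrite -[M * T ^+ (d - 1)]/(a _) -/x -/T.
  have -> : (if d is d'.+1 then (M * T ^+ d') (n - 2)%N else 0) =
    if d is d'.+1 then a d' (n - 2)%N else 0 by case: d.
  move: a => a.
  case: n {nm} => [|[|n]]; case: d => [|d] /=; rewrite ?subSS ?subn0; ring.
Qed.
End Enumeration.

(** * Closed forms of the generating functions *)

Lemma fps_coef_sum (R : comNzRingType) (I : Type) (r : seq I) (F : I -> {fps R}) n :
  (\sum_(i <- r) F i) n = \sum_(i <- r) F i n.
Proof. by elim/big_rec2: _ => // i y z _ <-. Qed.

Lemma fps_coef0_neq0 (R : comNzRingType) (a : {fps R}) : a 0%N != 0 -> a != 0.
Proof. by apply: contraNneq => ->. Qed.

Lemma fps_coefM0 (R : comNzRingType) (a b : {fps R}) : (a * b) 0%N = a 0%N * b 0%N.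
Proof. by rewrite fps_coefM big_ord1. Qed.

Section GeneratingFunctions.
Variables (R : comNzRingType) (M : {fps R}).
Let x := fps_X R.
Hypothesis ME : M = 1 + (x + x ^+ 2) * M + x ^+ 3 * M ^+ 2.
Let T := x ^+ 2 * M.
Let W := T + T ^+ 2.

Lemma j_coef n k : (j n k)%:R = (M * W ^+ k) n.
Proof.
have [s [us sP sE]] := dominated_pairs_enum ME n k 0.
by rewrite expr0 mulr1 in sE; rewrite (card_path_pairs us sP) sE.
Qed.

(** Summing [M * W ^+ k] over [k] is a geometric series. As [x] divides [W], only the terms with
    [k <= n] reach the coefficient [n], so finite sums suffice. *)
Lemma intervals_series :
  (1 - W) * Fps (fun n => #|intervals n|%:R) = M.
Proof.
have W0 n k : (n < k)%N -> (M * W ^+ k) n = 0.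
  move=> nk; have -> : M * W ^+ k = x ^+ k * (M * (x * M * (1 + T)) ^+ k).
    by rewrite mulrCA -exprMn; congr (_ * _ ^+ k); rewrite /W /T; ring.
  exact: fps_coef_Xpow_small.
apply/fpsP => n.
have -> : ((1 - W) * Fps (fun n => #|intervals n|%:R)) n =
          ((1 - W) * \sum_(k < n.+1) M * W ^+ k) n.
  apply: fps_eqM => // i iN /=; rewrite card_intervals natr_sum fps_coef_sum.
  rewrite (eq_bigr (fun k : 'I_i.+1 => (M * W ^+ k) i)); last by move=> k _; exact: j_coef.
  rewrite -!(big_mkord predT (fun k => (M * W ^+ k) i)) [RHS](big_cat_nat _ (n := i.+1)) //=.
  rewrite [X in _ + X]big_nat_cond [X in _ + X]big1 ?addr0 // => k /andP[/andP[ik _] _].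
  exact: W0.
rewrite -mulr_sumr mulrCA -opprB mulNr -subrX1 mulrN mulrBr mulr1 opprB.
by rewrite fps_coefD fps_coefN W0 // subr0.
Qed.

End GeneratingFunctions.

(** Completing the square in the quadratic equation of [M], whose discriminant is
    [(1 - x - x^2)^2 - 4 x^3]. *)
Lemma motzkin_sqrt (R : comNzRingType) (x M : R) :
    M = 1 + (x + x ^+ 2) * M + x ^+ 3 * M ^+ 2 ->
  (1 - x - x ^+ 2 - 2 * x ^+ 3 * M) ^+ 2 =
  x ^+ 4 - 2 * x ^+ 3 - x ^+ 2 - 2 * x + 1.
Proof.
move=> ME; apply/eqP; rewrite -subr_eq0.
rewrite (_ : _ - _ = 4 * x ^+ 3 * ((1 + (x + x ^+ 2) * M + x ^+ 3 * M ^+ 2) - M)); last by ring.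
by rewrite -ME subrr mulr0.
Qed.

Lemma intervals_gf_closed (R : idomainType) (M : {fps R}) :
    let x := fps_X R in
    M = 1 + (x + x ^+ 2) * M + x ^+ 3 * M ^+ 2 ->
  Fps (fun n => #|intervals n|%:R) *
    (2 * x * (x ^+ 2 - 3 * x + 1) * (x + 1)) =
  - x ^+ 2 + 3 * x - 1 + (1 - x - x ^+ 2 - 2 * x ^+ 3 * M).
Proof.
move=> x ME; have := intervals_series ME; rewrite -/x.
pose W := x ^+ 2 * M + (x ^+ 2 * M) ^+ 2; set g := Fps _; rewrite -/W => gE.
have W1 : 1 - W != 0.
  apply: fps_coef0_neq0; rewrite fps_coefD fps_coefN !(fps_coefD, expr2, fps_coefM0).
  by rewrite /= !(mul0r, mulr0, addr0) subr0 oner_neq0.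
apply: (mulfI W1); rewrite [LHS]mulrA.
 rewrite gE.
have E0 : M - (1 + (x + x ^+ 2) * M + x ^+ 3 * M ^+ 2) = 0 by rewrite -ME subrr.
apply/eqP; rewrite -subr_eq0.
(* The cofactor of the equation of [M] in the difference of the two sides. *)
pose c := 2 * x * (x ^+ 3 * M + 1 - x).
rewrite (_ : _ - _ = c * (M - (1 + (x + x ^+ 2) * M + x ^+ 3 * M ^+ 2))); last first.
  by rewrite /W /c; ring.
by rewrite E0 mulr0.
Qed.

Lemma fps_coefCM (R : comNzRingType) (r : R) (a : {fps R}) n :
  (fps_C r * a) n = r * a n.
Proof.
rewrite fps_coefM big_ord_recl /= subn0 big1 ?addr0 // => i _.
by rewrite mul0r.
Qed.

Section Lift.
Variable R : comNzRingType.

(** A series in [x] seen as a series in [x] and [y] constant in [y]. This is a ring morphism, so the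
    equation of [M] carries over to two variables. *)
Definition fps_lift (a : {fps R}) : {fps2 R} := Fps (fun n => fps_C (a n)).

Lemma fps_lift_coefM (a : {fps R}) (g : {fps2 R}) n k :
  (fps_lift a * g) n k = \sum_(i < n.+1) a i * g (n - i)%N k.
Proof.
rewrite fps_coefM fps_coef_sum; apply: eq_bigr => i _; exact: fps_coefCM.
Qed.

Fact fps_lift_additive : zmod_morphism fps_lift.
Proof.
move=> a b; apply/fpsP => n; apply/fpsP => k.
rewrite !(fps_coefD, fps_coefN) /=; case: (k == 0%N) => //.
by rewrite subr0.
Qed.

Fact fps_lift_multiplicative : monoid_morphism fps_lift.
Proof.
split=> [|a b]; apply/fpsP => n; apply/fpsP => k.
  by rewrite fps_coef1 /=; case: n k => [|n] [|k].
rewrite fps_lift_coefM /=; case: eqP => _; first by [].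
by rewrite big1 // => i _; rewrite mulr0.
Qed.

HB.instance Definition _ :=
  GRing.isZmodMorphism.Build _ _ fps_lift fps_lift_additive.
HB.instance Definition _ :=
  GRing.isMonoidMorphism.Build _ _ fps_lift fps_lift_multiplicative.

Lemma fps_liftX : fps_lift (fps_X R) = var_x R.
Proof. by apply/fpsP => n; apply/fpsP => k /=; case: n k => [|[|n]] [|k]. Qed.

End Lift.

Lemma tofrac_div (R : idomainType) (a b c : R) : c != 0 -> a * c = b ->
  a%:F = b%:F / c%:F :> {fraction R}.
Proof.
by move=> c0 <-; rewrite tofracM mulfK // tofrac_eq0.
Qed.

Lemma gf_j_series (M : {fps rat}) : let x := fps_X rat in
    let W := x ^+ 2 * M + (x ^+ 2 * M) ^+ 2 in
    M = 1 + (x + x ^+ 2) * M + x ^+ 3 * M ^+ 2 ->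
  (1 - var_y rat * fps_lift W) * gf_j = fps_lift M.
Proof.
move=> x W ME; apply/fpsP => n; apply/fpsP => k.
have jE i l : gf_j i l = (M * W ^+ l) i by rewrite -(j_coef ME).
rewrite mulrBl mul1r -mulrA !fps_coefD !fps_coefN /var_y fps_coefCM fps_coefXM jE.
case: k => [|k]; first by rewrite oppr0 addr0 expr0 mulr1.
apply/eqP; rewrite subr_eq0 fps_lift_coefM; apply/eqP.
by rewrite exprSr mulrA mulrC fps_coefM; apply: eq_bigr => i _; rewrite jE.
Qed.

(** The constant coefficient 1 selects the sign of the root. Leaving [x] general covers both one and
    two variables. *)
Lemma fps_sqrt_discriminant (R : idomainType) (x M : {fps R}) :
    2 != 0 :> R -> x 0%N = 0 -> M = 1 + (x + x ^+ 2) * M + x ^+ 3 * M ^+ 2 ->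
  fps_sqrt (x ^+ 4 - 2 * x ^+ 3 - x ^+ 2 - 2 * x + 1) =
    1 - x - x ^+ 2 - 2 * x ^+ 3 * M.
Proof.
move=> two x0 ME; rewrite -(motzkin_sqrt ME) fps_sqrtE //.
rewrite !(fps_coefD, fps_coefN, fps_coefM0, exprS, expr0, fps_coef1) x0.
by rewrite !(mul0r, mulr0) !subr0.
Qed.

Lemma gf_j_closed :
  let x := var_x rat in
  let y := var_y rat in
  let s := fps_sqrt (x ^+ 4 - 2 * x ^+ 3 - x ^+ 2 - 2 * x + 1) in
  gf_j%:F =
    (1 + x - x ^+ 2 + s)%:F /
    ((1 - x ^+ 2) * s + 1 + x ^+ 4 - x ^+ 3 - 2 * (y + 1) * x ^+ 2 - x)%:F.
Proof.
have [M0 M0E] := motzkin_series rat.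
have jE := gf_j_series M0E.
move=> x y s.
pose M := fps_lift M0.
have ME : M = 1 + (x + x ^+ 2) * M + x ^+ 3 * M ^+ 2.
  by rewrite {1}/M M0E !(rmorphD, rmorphM, rmorphXn, rmorph1) /= fps_liftX.
have x0 : x 0%N = 0 by [].
have two : 2 != 0 :> {fps rat}.
  by apply: fps_coef0_neq0; rewrite fps_coefD !fps_coef1.
have sE : s = 1 - x - x ^+ 2 - 2 * x ^+ 3 * M by apply: fps_sqrt_discriminant.
have {}jE : (1 - y * (x ^+ 2 * M + (x ^+ 2 * M) ^+ 2)) * gf_j = M.
  by move: jE; rewrite !(rmorphD, rmorphM, rmorphXn, rmorph1) /= fps_liftX.
have c0 (a : {fps2 rat}) m : (x ^+ m.+1 * a) 0%N = 0.
  by rewrite exprS -mulrA fps_coefXM.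
apply: tofrac_div.
  rewrite sE; set d := (X in X != 0).
  (* The denominator is nonzero because its coefficient of [x^0] is 2. *)
  have -> : d = 2 + x ^+ 1 * (- 2 - 4 * x + 2 * x ^+ 3
     - 2 * x ^+ 2 * M * (1 - x ^+ 2) - 2 * y * x) by rewrite /d; ring.
  by apply: fps_coef0_neq0; rewrite fps_coefD c0 addr0 fps_coefD !fps_coef1.
set N := 1 + x - x ^+ 2 + s; set d := (X in _ * X = N).
pose W := x ^+ 2 * M + (x ^+ 2 * M) ^+ 2; rewrite -/W in jE.
have W1 : 1 - y * W != 0.
  apply: fps_coef0_neq0; rewrite fps_coefD fps_coefN.
  rewrite (_ : y * W = x ^+ 2 * (y * M * (1 + x ^+ 2 * M))).
    by rewrite c0 subr0 fps_coef1 oner_neq0.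
  by rewrite /W; ring.
apply: (mulfI W1); rewrite mulrA jE /d /N sE /W.
have E0 : M - (1 + (x + x ^+ 2) * M + x ^+ 3 * M ^+ 2) = 0 by rewrite -ME subrr.
apply/eqP; rewrite -subr_eq0.
rewrite (_ : _ - _ = (2 - 2 * x ^+ 2 + 2 * y * x ^+ 4 * M) *
  (M - (1 + (x + x ^+ 2) * M + x ^+ 3 * M ^+ 2))); last by ring.
by rewrite E0 mulr0.
Qed.

Lemma gf_intervals_closed :
  let x := fps_X rat in
  let s := fps_sqrt (x ^+ 4 - 2 * x ^+ 3 - x ^+ 2 - 2 * x + 1) in
  gf_intervals%:F =
    (- x ^+ 2 + 3 * x - 1 + s)%:F /
    (2 * x * (x ^+ 2 - 3 * x + 1) * (x + 1))%:F.
Proof.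
move=> x s.
have [M ME] := motzkin_series rat; rewrite -/x in ME.
have sE : s = 1 - x - x ^+ 2 - 2 * x ^+ 3 * M by exact: fps_sqrt_discriminant.
apply: tofrac_div; last by rewrite sE; exact: intervals_gf_closed.
have X0 : x != 0 by apply/eqP => /fpsP/(_ 1%N)/eqP; rewrite /= oner_eq0.
have two : 2 != 0 :> {fps rat}.
  by apply: fps_coef0_neq0; rewrite fps_coefD !fps_coef1.
have one0 (a : {fps rat}) : 1 + x * a != 0.
  by apply: fps_coef0_neq0; rewrite fps_coefD fps_coefXM addr0 fps_coef1 oner_neq0.
rewrite !mulf_neq0 //.
  by rewrite (_ : _ + 1 = 1 + x * (x - 3)) //; ring.
by rewrite (_ : _ + 1 = 1 + x * 1) //; ring.
Qed.

(** * Wallis' inequalities *)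

Section Wallis.
Variable R : realType.
Implicit Types (n : nat) (x : R).

(** This is [binom(2n, n) / 4^n], the coefficient of [x^n] in [(1 - x)^(-1/2)]. *)
Fixpoint central n : R :=
  if n is m.+1 then (2 * m%:R + 1) / (2 * m%:R + 2) * central m else 1.

Lemma central_gt0 n : 0 < central n.
Proof.
by elim: n => //= n IH; rewrite mulr_gt0 // divr_gt0 // -natrM -natrD ltr0n; lia.
Qed.

(* A primitive of [sin x ^+ n], from the reduction formula. *)
Fixpoint sin_prim n : R -> R :=
  match n with
  | 0 => id
  | 1 => fun x => - cos x
  | (m.+1 as m').+1 => fun x =>
      (m'%:R * sin_prim m x - cos x * sin x ^+ m') / m'.+1%:R
  end.

Lemma is_derive_sin_prim n x : is_derive x 1 (sin_prim n) (sin x ^+ n).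
Proof.
have [m] := ubnP n; elim: m n => // m IH [|[|n]] nm.
- by rewrite expr0; exact: is_derive_id.
- by rewrite expr1; apply: is_derive_eq; rewrite opprK.
have IHn : is_derive x 1 (sin_prim n) (sin x ^+ n) by apply: IH; lia.
have -> : sin_prim n.+2 = n.+2%:R^-1 *: (n.+1%:R *: sin_prim n - cos * (@sin R) ^+ n.+1).
  by apply/funext => z; rewrite /= mulrC !fctE.
apply: is_derive_eq.
rewrite fctE /GRing.scale /= !exprS.
apply: (mulfI (_ : n.+2%:R != 0)); first by rewrite pnatr_eq0.
rewrite mulVKf ?pnatr_eq0 //.
have c2 : cos x * cos x = 1 - sin x * sin x.
  by rewrite -(cos2Dsin2 x); ring.
transitivity (n.+1%:R * sin x ^+ n * (1 - cos x * cos x) + sin x * sin x * sin x ^+ n).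
  by ring.
by rewrite c2 -[n.+2]addn1 natrD; ring.
Qed.

(** The integral of [sin x ^+ n] from 0 to [pi / 2], expressed by the primitive. *)
Definition wallis n : R := sin_prim n (pi / 2) - sin_prim n 0.

Lemma wallisSS n : wallis n.+2 = n.+1%:R / n.+2%:R * wallis n.
Proof.
rewrite /wallis /= cos_pihalf sin0 expr0n /= mul0r mulr0 !subr0.
by rewrite -mulrBl -mulrBr mulrAC.
Qed.

Lemma wallis0 : wallis 0 = pi / 2. Proof. by rewrite /wallis subr0. Qed.

Lemma wallis1 : wallis 1 = 1.
Proof. by rewrite /wallis /= cos_pihalf cos0 oppr0 opprK add0r. Qed.

Lemma wallis_even n : wallis n.*2 = pi / 2 * central n.
Proof.
elim: n => [|n IH]; first by rewrite wallis0 mulr1.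
rewrite doubleS wallisSS IH /= -muln2 -[(_ * 2).+2]addn2 -[(_ * 2).+1]addn1.
rewrite !natrD natrM; have := ler0n R n; move: (n%:R) => m m0.
by field; rewrite !lt0r_neq0 //; lra.
Qed.

Lemma wallis_odd n : wallis n.*2.+1 = ((2 * n%:R + 1) * central n)^-1.
Proof.
elim: n => [|n IH]; first by rewrite wallis1 mulr0 add0r !mul1r invr1.
rewrite doubleS wallisSS IH /= -muln2 -[(_ * 2).+3]addn3 -[(_ * 2).+2]addn2.
rewrite !natrD natrM -(natr1 n).
have := central_gt0 n; have := ler0n R n; move: (central n) (n%:R) => c m m0 c0.
by field; rewrite !lt0r_neq0 //; lra.
Qed.

(** The difference of the two primitives has derivative [sin x ^+ n - sin x ^+ n.+1], which is
    nonnegative on the interval, hence it is nondecreasing there. *)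
Lemma wallis_decr n : wallis n.+1 <= wallis n.
Proof.
have der x : is_derive x 1 (sin_prim n - sin_prim n.+1) (sin x ^+ n - sin x ^+ n.+1).
  by apply: is_deriveB; exact: is_derive_sin_prim.
have pih : (0 : R) <= pi / 2 by rewrite divr_ge0 // pi_ge0.
rewrite -subr_ge0 /wallis.
have -> : sin_prim n (pi / 2) - sin_prim n 0 - (sin_prim n.+1 (pi / 2) - sin_prim n.+1 0)
  = (sin_prim n - sin_prim n.+1) (pi / 2) - (sin_prim n - sin_prim n.+1) 0.
  by rewrite !fctE; ring.
rewrite subr_ge0.
apply: (@ger0_derive1_le_cc _ _ 0 (pi / 2)).
- by move=> x _; have [] := der x.
- move=> x /itvP xI; rewrite derive1E derive_val exprS.
  have sx : 0 <= sin x by apply/ltW/sin_gt0_pihalf; rewrite !xI.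
  by rewrite -{1}[sin x ^+ n]mul1r -mulrBl mulr_ge0 ?exprn_ge0 // subr_ge0 sin_le1.
- apply: continuous_subspaceT => x; apply: differentiable_continuous.
  by apply/derivable1_diffP; have [] := der x.
- by rewrite in_itv /= lexx.
- by rewrite in_itv /= lexx andbT.
- exact: pih.
Qed.

(** Comparison of the Wallis integrals of orders [2n] and [2n + 1]; the upper bound below compares
    the next two orders. *)
Lemma central_sqr_ge n : 2 / (pi * (2 * n%:R + 1)) <= central n ^+ 2.
Proof.
have := wallis_decr n.*2; rewrite wallis_odd wallis_even.
have := central_gt0 n; have := ler0n R n; have := pi_gt0 R.
move: (central n) (n%:R) (pi) => c m p p0 m0 c0 h.
rewrite ler_pdivrMr ?mulr_gt0 //; last by lra.
have cm : 0 < (2 * m + 1) * c by rewrite mulr_gt0 //; lra.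
have := ler_wpM2r (ltW cm) h; rewrite mulVf ?lt0r_neq0 // expr2; lra.
Qed.

Lemma central_sqr_le n : (0 < n)%N -> central n ^+ 2 <= (pi * n%:R)^-1.
Proof.
case: n => // n _; have := wallis_decr n.*2.+1.
rewrite wallis_odd -doubleS wallis_even /= -(natr1 n).
have := central_gt0 n; have := ler0n R n; have := pi_gt0 R.
move: (central n) (n%:R) (pi) => c m p p0 m0 c0 h.
have cm : 0 < (2 * m + 1) * c by rewrite mulr_gt0 //; lra.
have m1 : 2 * m + 2 != 0 by apply: lt0r_neq0; lra.
have := ler_wpM2r (ltW cm) h; rewrite mulVf ?lt0r_neq0 // => h1.
rewrite -[leRHS]mul1r ler_pdivlMr; last by rewrite mulr_gt0 //; lra.
apply: le_trans h1; rewrite le_eqVlt; apply/orP; left; apply/eqP.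
by field; lra.
Qed.

End Wallis.

(** * Evaluation of absolutely convergent series *)

Lemma sum_triangle (V : zmodType) (F : nat -> nat -> V) n :
  \sum_(k < n) \sum_(i < k.+1) F i (k - i)%N = \sum_(i < n) \sum_(l < n - i) F i l.
Proof.
elim: n => [|n IH]; first by rewrite !big_ord0.
rewrite big_ord_recr IH [RHS]big_ord_recr subSn // subnn /= big_ord1.
rewrite big_ord_recr /= subnn addrA -big_split; congr (_ + _).
by apply: eq_bigr => i _; rewrite subSn 1?ltnW //= big_ord_recr.
Qed.

Section WeightedNorm.
Variable R : realFieldType.
Implicit Types (a b : {fps R}) (r : R) (n : nat).

(** Truncating the weighted norm at order [n] keeps every estimate a finite sum; convergence becomes
    a bound uniform in [n]. *)
Definition wnorm r n a := \sum_(i < n) `|a i| * r ^+ i.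

Definition summable_at r a := exists K, forall n, wnorm r n a <= K.

Lemma wnorm_ge0 r n a : 0 <= r -> 0 <= wnorm r n a.
Proof. by move=> r0; apply: sumr_ge0 => i _; rewrite mulr_ge0 ?exprn_ge0. Qed.

Lemma wnormD r n a b : 0 <= r -> wnorm r n (a + b) <= wnorm r n a + wnorm r n b.
Proof.
move=> r0; rewrite -big_split; apply: ler_sum => i _ /=.
by rewrite -mulrDl ler_wpM2r ?exprn_ge0 // ler_normD.
Qed.

(** The truncated product involves only the index pairs of sum less than [n], a triangle inside the
    square of all pairs. *)
Lemma wnormM r n a b : 0 <= r -> wnorm r n (a * b) <= wnorm r n a * wnorm r n b.
Proof.
move=> r0; pose F i l := (`|a i| * r ^+ i) * (`|b l| * r ^+ l).
have F0 i l : 0 <= F i l by rewrite !mulr_ge0 ?exprn_ge0.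
apply: (@le_trans _ _ (\sum_(k < n) \sum_(i < k.+1) F i (k - i)%N)).
  apply: ler_sum => k _; rewrite fps_coefM.
  apply: le_trans (ler_wpM2r (exprn_ge0 _ r0) (ler_norm_sum _ _ _)) _.
  rewrite mulr_suml; apply: ler_sum => i _; rewrite /F normrM.
  rewrite mulrACA -exprD subnKC //; exact: ltnSE.
rewrite sum_triangle mulr_suml; apply: ler_sum => i _.
rewrite mulr_sumr (big_ord_widen n (F i) (leq_subr i n)).
by rewrite [leLHS]big_mkcond; apply: ler_sum => l _; case: ifP => // _; exact: F0.
Qed.

Lemma wnormXM r n a : wnorm r n.+1 (fps_X R * a) = r * wnorm r n a.
Proof.
rewrite /wnorm big_ord_recl fps_coefXM normr0 mul0r add0r mulr_sumr.
by apply: eq_bigr => i _; rewrite fps_coefXM /= exprS mulrCA.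
Qed.

Lemma wnormS r n a : 0 <= r -> wnorm r n a <= wnorm r n.+1 a.
Proof. by move=> r0; rewrite /wnorm big_ord_recr /= lerDl mulr_ge0 ?exprn_ge0. Qed.

Lemma wnormXM_le r n a : 0 <= r -> wnorm r n (fps_X R * a) <= r * wnorm r n a.
Proof.
move=> r0; case: n => [|n]; first by rewrite /wnorm !big_ord0 mulr0.
by rewrite wnormXM ler_wpM2l // wnormS.
Qed.

Lemma wnormC r n c : wnorm r n (fps_C c) <= `|c|.
Proof.
case: n => [|n]; first by rewrite /wnorm big_ord0.
rewrite /wnorm big_ord_recl big1 ?addr0 ?mulr1 //= => i _.
by rewrite normr0 mul0r.
Qed.

(* With [g = 1 - p] the equation reads [2 p = p ^+ 2 + q], which bounds the norm
   of [p] up to order [n] by its norm up to order [n - 1]. *)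
Lemma summable_at_sqrt r (g q : {fps R}) : 0 <= r -> g 0%N = 1 -> g ^+ 2 = 1 - q ->
  (forall n, wnorm r n q <= 1) -> summable_at r g.
Proof.
move=> r0 g0 gq q1; pose p := 1 - g.
have p0 : p 0%N = 0 by rewrite fps_coefD fps_coefN g0 fps_coef1 subrr.
have p2 : p *+ 2 = p ^+ 2 + q.
  rewrite (_ : q = 1 - g ^+ 2); last by rewrite gq opprB addrC subrK.
  by rewrite /p; ring.
pose p' := Fps (fun n => p n.+1).
have pE : p = fps_X R * p' by apply/fpsP => -[|n]; rewrite fps_coefXM.
have p1 n : wnorm r n p <= 1.
  elim: n => [|[|n] IH]; first by rewrite /wnorm big_ord0.
    by rewrite /wnorm big_ord1 p0 normr0 mul0r.
  have : wnorm r n.+2 (p *+ 2) = wnorm r n.+2 p *+ 2.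
    by rewrite /wnorm -sumrMnl; apply: eq_bigr => i _; rewrite fps_coefMn normrMn mulrnAl.
  have : wnorm r n.+2 (p *+ 2) <= 2.
    rewrite p2; apply: le_trans (wnormD _ _ _ r0) _; apply: lerD => //.
    have -> : p ^+ 2 = fps_X R * (fps_X R * (p' * p')) by rewrite pE; ring.
    rewrite !wnormXM.
    have : (r * wnorm r n p') ^+ 2 <= 1.
      by rewrite expr_le1 ?mulr_ge0 ?wnorm_ge0 // -wnormXM -pE.
    apply: le_trans; rewrite expr2 mulrACA mulrA ler_wpM2l ?mulr_ge0 //.
    exact: wnormM.
  by move=> h1 h2; move: h1; rewrite h2; lra.
exists 2 => n.
have -> : g = 1 + - p by rewrite /p; ring.
apply: le_trans (wnormD _ _ _ r0) _.
have : wnorm r n (- p) <= 1.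
  by apply: le_trans (p1 n); apply: ler_sum => i _; rewrite fps_coefN normrN.
have := wnormC r n 1; rewrite normr1 -[fps_C 1]/(1 : {fps R}); lra.
Qed.

Lemma summable_at_leq r a : 0 <= r -> (forall i, `|a i| <= 1) -> r < 1 -> summable_at r a.
Proof.
move=> r0 a1 r1; exists (1 - r)^-1 => n.
apply: (@le_trans _ _ (\sum_(i < n) r ^+ i)).
  by apply: ler_sum => i _; rewrite ler_piMl ?exprn_ge0.
rewrite -[leRHS]mul1r ler_pdivlMr ?subr_gt0 // mulrC.
rewrite -opprB mulNr -subrX1 opprB gerBl; exact: exprn_ge0.
Qed.

End WeightedNorm.

Section Evaluation.
Variables (R : realType) (r rho : R).
Hypotheses (rho_gt0 : 0 < rho) (rho_lt : rho < r).
Implicit Types (a b : {fps R}) (l m : R) (n : nat).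

Definition partial_value n a := \sum_(i < n) a i * rho ^+ i.

(** Summability is required at [r], beyond the point [rho] of evaluation, so that errors carry
    powers of [q = rho / r < 1]. *)
Definition has_value a l :=
  summable_at r a /\ (fun n => partial_value n a) @ \oo --> l.

Let r_gt0 : 0 < r. Proof. exact: lt_trans rho_lt. Qed.
Let q := rho / r.
Let q_ge0 : 0 <= q. Proof. by rewrite divr_ge0 // ltW. Qed.
Let q_lt1 : q < 1. Proof. by rewrite ltr_pdivrMr // mul1r. Qed.

Let rhoE i : rho ^+ i = r ^+ i * q ^+ i.
Proof. by rewrite -exprMn mulrC divfK // lt0r_neq0. Qed.

Lemma has_value_exists a : summable_at r a -> exists l, has_value a l.
Proof.
move=> sa; have [K aK] := sa.
pose u i := a i * rho ^+ i.
have cu : cvgn [normed series u].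
  apply: nondecreasing_is_cvgn.
    by apply: nondecreasing_series => i _ _; exact: normr_ge0.
  exists K => _ [n _ <-]; apply: le_trans (aK n).
  rewrite /= /series /= big_mkord; apply: ler_sum => i _.
  rewrite normrM normrX (gtr0_norm rho_gt0) ler_wpM2l //.
  by rewrite lerXn2r ?nnegrE ?ltW.
exists (limn (series u)); split=> //.
have := normed_cvg cu; rewrite (_ : series u = fun n => partial_value n a) //.
by apply/funext => n; rewrite /series /= big_mkord.
Qed.

Lemma has_value_uniq a l m : has_value a l -> has_value a m -> l = m.
Proof. by move=> [_ al] [_ am]; exact: cvg_unique al am. Qed.

Lemma has_valueC c : has_value (fps_C c) c.
Proof.
have sumC (F : R -> R) (s : R) n : F 0 = 0 ->
    \sum_(i < n.+1) F (fps_C c i) * s ^+ i = F c.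
  move=> F0; rewrite big_ord_recl mulr1 big1 ?addr0 // => i _.
  by rewrite F0 mul0r.
split.
  exists `|c| => -[|n]; first by rewrite /wnorm big_ord0.
  by rewrite /wnorm sumC ?normr0.
rewrite -cvg_shiftS /=; apply: cvg_near_cst; apply: nearW => n.
exact: (sumC id).
Qed.

Lemma has_valueX a l : has_value a l -> has_value (fps_X R * a) (rho * l).
Proof.
move=> [[K aK] al]; split.
  exists (r * K) => -[|n].
    rewrite /wnorm big_ord0; apply: mulr_ge0; first exact: ltW.
    by apply: le_trans (aK 0%N); rewrite /wnorm big_ord0.
  by rewrite wnormXM ler_wpM2l // ltW.
rewrite -cvg_shiftS /=.
rewrite (_ : (fun n => _) = (fun n => rho * partial_value n a)); first exact: cvgMr.
apply/funext => n; rewrite /partial_value big_ord_recl fps_coefXM mul0r add0r mulr_sumr.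
by apply: eq_bigr => i _; rewrite fps_coefXM /= exprS mulrCA.
Qed.

Lemma has_valueD a b l m :
  has_value a l -> has_value b m -> has_value (a + b) (l + m).
Proof.
move=> [[K aK] al] [[L bL] bm]; split.
  exists (K + L) => n; apply: le_trans (wnormD _ _ _ (ltW r_gt0)) _; exact: lerD.
rewrite (_ : (fun n => _) = (fun n => partial_value n a + partial_value n b)).
  exact: cvgD.
apply/funext => n; rewrite /partial_value -big_split; apply: eq_bigr => i _.
by rewrite fps_coefD mulrDl.
Qed.

Lemma has_valueN a l : has_value a l -> has_value (- a) (- l).
Proof.
move=> [[K aK] al]; split.
  exists K => n; apply: le_trans (aK n); apply: ler_sum => i _.
  by rewrite fps_coefN normrN.
rewrite (_ : (fun n => _) = (fun n => - partial_value n a)); first exact: cvgN.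
apply/funext => n; rewrite /partial_value -sumrN; apply: eq_bigr => i _.
by rewrite fps_coefN mulNr.
Qed.

Lemma has_valueM a b l m :
  has_value a l -> has_value b m -> has_value (a * b) (l * m).
Proof.
move=> [[K aK] al] [[L bL] bm].
have K0 : 0 <= K by apply: le_trans (aK 0%N); rewrite /wnorm big_ord0.
split.
  exists (K * L) => n; apply: le_trans (wnormM _ _ _ (ltW r_gt0)) _.
  by rewrite ler_pM // wnorm_ge0 // ltW.
pose F i j := (a i * rho ^+ i) * (b j * rho ^+ j).
have pM n : partial_value n (a * b) = \sum_(i < n) \sum_(j < n - i) F i j.
  rewrite -sum_triangle; apply: eq_bigr => k _; rewrite fps_coefM mulr_suml.
  apply: eq_bigr => i _; rewrite /F mulrACA -exprD subnKC //; exact: ltnSE.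
(* Only the products of index sum at least [n] survive in the difference, and each of them carries a
   factor at most [q ^+ n]. *)
have dist n : `|partial_value n a * partial_value n b - partial_value n (a * b)|
    <= q ^+ n * (K * L).
  rewrite pM mulr_suml -sumrB; apply: le_trans (ler_norm_sum _ _ _) _.
  apply: (@le_trans _ _ (q ^+ n * (wnorm r n a * wnorm r n b))); last first.
    by rewrite ler_wpM2l ?exprn_ge0 // ler_pM // wnorm_ge0 // ltW.
  rewrite mulr_suml mulr_sumr; apply: ler_sum => i _.
  rewrite (big_ord_widen n (F i) (leq_subr i n)) [X in _ - X]big_mkcond mulr_sumr -sumrB.
  apply: le_trans (ler_norm_sum _ _ _) _; rewrite !mulr_sumr; apply: ler_sum => k _.
  have pos : 0 <= `|a i| * r ^+ i * (`|b k| * r ^+ k).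
    by rewrite !mulr_ge0 ?exprn_ge0 // ltW.
  case: ifPn => [_|]; first by rewrite /F subrr normr0 mulr_ge0 ?exprn_ge0.
  rewrite -leqNgt => nik; rewrite subr0 !normrM !normrX !(gtr0_norm rho_gt0) !rhoE.
  rewrite [leLHS](_ : _ = q ^+ (i + k) * (`|a i| * r ^+ i * (`|b k| * r ^+ k))); last first.
    by rewrite exprD; ring.
  by apply: ler_wpM2r => //; apply: ler_wiXn2l; [exact: q_ge0|exact: ltW|lia].
have cab : (fun n => partial_value n a * partial_value n b) @ \oo --> l * m by exact: cvgM.
have d0 : (fun n => partial_value n a * partial_value n b -
    partial_value n (a * b)) @ \oo --> (0 : R).
  apply/norm_cvg0P; apply: (@squeeze_cvgr _ _ _ _ (fun=> 0)
    (fun n => q ^+ n * (K * L))).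
  - by apply: nearW => n; rewrite normr_ge0 dist.
  - exact: cvg_cst.
  - rewrite -[X in _ --> X](mul0r (K * L)); apply: cvgMl; apply: cvg_expr.
    by rewrite ger0_norm.
rewrite -[X in _ --> X]subr0.
rewrite (_ : (fun n => _) = (fun n => partial_value n a * partial_value n b -
    (partial_value n a * partial_value n b - partial_value n (a * b)))).
  exact: cvgB.
by apply/funext => n; rewrite opprB addrC subrK.
Qed.

End Evaluation.

(** * Transfer of asymptotics *)

Section CentralCoefficients.
Variable R : realType.
Local Notation central := (@central R).

Lemma centralS n : central n.+1 * (2 * n%:R + 2) = (2 * n%:R + 1) * central n.
Proof.
by rewrite /= mulrAC divfK // lt0r_neq0.
Qed.

(** The ratio [(2m + 1) / (2m + 2)] of consecutive terms increases with [m]. *)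
Lemma central_supermul a b : central a * central b <= central (a + b).
Proof.
elim: b => [|b IH]; first by rewrite addn0 mulr1.
rewrite addnS /= mulrCA.
have b0 := ler0n R b; have a0 := ler0n R a.
apply: le_trans (ler_wpM2l _ IH) _; first by rewrite divr_ge0 //; lra.
apply: ler_wpM2r; first exact/ltW/central_gt0.
by rewrite natrD ler_pdivrMr; [rewrite mulrAC ler_pdivlMr|]; nra.
Qed.

Lemma central_ge_inv n : 1 <= n.+1%:R * central n.
Proof.
elim: n => [|n IH]; first by rewrite mul1r.
have n0 := ler0n R n; have c0 := central_gt0 R n.
apply: le_trans IH _; rewrite /= mulrA; apply: ler_wpM2r; first exact: ltW.
by rewrite mulrA ler_pdivlMr; rewrite -?natr1; nra.
Qed.

Lemma central_decr i n : (i <= n)%N -> central n <= central (n - i).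
Proof.
elim: i => [|i IH] iN; first by rewrite subn0.
apply: le_trans (IH (ltnW iN)) _; rewrite (_ : (n - i = (n - i.+1).+1)%N); last by lia.
have c0 := central_gt0 R (n - i.+1); have n0 := ler0n R (n - i.+1).
rewrite [leLHS]/= ger_pMl // ler_pdivrMr; lra.
Qed.

Lemma central_sub_le i n : (i <= n)%N -> central (n - i) <= i.+1%:R * central n.
Proof.
move=> iN; have := central_supermul (n - i) i; rewrite subnK //.
have := central_ge_inv i; have := central_gt0 R (n - i).
have := central_gt0 R i; have : 0 < i.+1%:R :> R by [].
move: (central n) (central (n - i)) (central i) (i.+1%:R) => w v u m m0 u0 v0 mu vu.
by apply: le_trans (ler_wpM2l (ltW m0) vu); nra.
Qed.

(** Consecutive terms [u], [v] at [m], [m + 1] satisfy [(u - v) (2m + 1) = v]. Adding the [i]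
    differences, each at most a square times [central n / n], yields the cube. *)
Lemma central_sub_diff i n : (i <= n)%N ->
  (central (n - i) - central n) * n%:R <= i%:R ^+ 3 * central n.
Proof.
elim: i => [|i IH] iN; first by rewrite subn0 subrr mul0r expr0n mul0r.
have {}IH := IH (ltnW iN); have le_i := central_sub_le (ltnW iN).
have := centralS (n - i.+1); rewrite (_ : (n - i.+1).+1 = (n - i)%N); last by lia.
have nE : n%:R = (n - i.+1)%:R + i%:R + 1 :> R.
  by rewrite -natrD natr1; congr (_%:R); lia.
have v0 := central_gt0 R (n - i); have w0 := central_gt0 R n.
move: IH le_i; rewrite -(natr1 i) nE.
have m0 := ler0n R (n - i.+1); have i0 := ler0n R i.
move: (central n) (central (n - i)) (central (n - i.+1)) ((n - i.+1)%:R) (i%:R : R) m0 i0 v0 w0.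
move=> w v u m t m0 t0 v0 w0 IH vw uv.
have uvE : (u - v) * (2 * m + 1) = v by lra.
have uv0 : 0 <= u - v.
  by rewrite -(pmulr_lge0 _ (_ : 0 < 2 * m + 1)) ?uvE ?ltW //; lra.
have h : (u - v) * (m + t + 1) <= (t + 1) * v.
  rewrite -[X in _ <= _ * X]uvE mulrCA; apply: ler_wpM2l => //.
  by have := mulr_ge0 m0 t0; lra.
have h2 : (t + 1) * v <= (t + 1) ^+ 2 * w by rewrite expr2 -mulrA ler_wpM2l //; lra.
rewrite (_ : (u - w) * _ = (u - v) * (m + t + 1) + (v - w) * (m + t + 1)); last by ring.
apply: le_trans (lerD (le_trans h h2) IH) _.
rewrite -mulrDl; apply: ler_wpM2r; first exact: ltW.
by nra.
Qed.

(** The square of [(1 - x)^(-1/2)] is [1 / (1 - x)]. By the symmetry of the sum, weighting its terms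
    by [i] multiplies it by half its order, while [(i + 1) c_(i+1) = (i + 1/2) c_i] links the
    weighted sum to the previous order. *)
Lemma central_conv n : \sum_(i < n.+1) central i * central (n - i) = 1.
Proof.
elim: n => [|n IH]; first by rewrite big_ord1 mulr1.
pose S m (f : nat -> R) := \sum_(i < m.+1) f i * (central i * central (m - i)).
have S_rev m : S m (fun i => i%:R) = S m (fun i => (m - i)%:R).
  rewrite /S (reindex_inj rev_ord_inj) /=; apply: eq_bigr => -[i /= im] _.
  by rewrite subSS subKn // [central _ * _]mulrC.
have S_half m : S m (fun i => i%:R) *+ 2 = m%:R * S m (fun=> 1).
  rewrite mulr2n {2}S_rev /S -big_split mulr_sumr; apply: eq_bigr => -[i /= im] _.
  by rewrite mul1r -mulrDl -natrD subnKC.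
have S1 : S n (fun=> 1) = 1 by rewrite -[RHS]IH; apply: eq_bigr => i _; rewrite mul1r.
have step : S n.+1 (fun i => i%:R) *+ 2 = n.+1%:R.
  have -> : S n.+1 (fun i => i%:R) = \sum_(i < n.+1) (i%:R + 2^-1) * (central i * central (n - i)).
    rewrite /S big_ord_recl mul0r add0r; apply: eq_bigr => i _.
    rewrite lift0 subSS -(natr1 i).
    have := centralS i; move: (central i.+1) (central i) (central (n - i)) (i%:R : R).
    move=> u v w t uv.
    have : (u * (2 * t + 2) - (2 * t + 1) * v) * w = 0 by rewrite uv subrr mul0r.
    by lra.
  under eq_bigr do rewrite mulrDl.
  rewrite big_split /= -mulr_sumr IH mulr1 -[X in X + _]/(S n (fun i => i%:R)) mulrnDl.
  by rewrite S_half S1 mulr1 -[2^-1 *+ 2]mulr_natr mulVf // natr1.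
have := S_half n.+1; rewrite step -[LHS]mulr1.
have n0 : n.+1%:R != 0 :> R by rewrite pnatr_eq0.
move/(mulfI n0) => S1'; rewrite [RHS]S1'.
by apply: eq_bigr => i _; rewrite mul1r.
Qed.

End CentralCoefficients.

Lemma cube_geometric_bounded (R : realFieldType) (q : R) : 0 <= q -> q < 1 ->
  exists C, forall i : nat, i%:R ^+ 3 * q ^+ i <= C.
Proof.
(* For [d <= 1] one has [(1 + d)^3 <= 1 + 7 d], so [(1 + d)^3 q <= (1 + 7 d) (1 - 7 d) <= 1].
   Bernoulli's inequality then bounds [(i d)^3 q^i] by 1. *)
move=> q0 q1; pose d := (1 - q) / 7.
have d0 : 0 < d by rewrite divr_gt0 // subr_gt0.
have qd : (1 + d) ^+ 3 * q <= 1.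
  have qE : q = 1 - 7 * d by rewrite /d; field.
  have d1 : 7 * d <= 1 by lra.
  by rewrite qE; move: (d) d0 d1 => e e0 e1; nra.
exists (d ^- 3) => i; rewrite -[leRHS]mul1r ler_pdivlMr ?exprn_gt0 //.
have bern : i%:R * d <= (1 + d) ^+ i.
  elim: i => [|i IH]; first by rewrite mul0r.
  have : 1 <= (1 + d) ^+ i by rewrite exprn_ege1 //; lra.
  rewrite exprS -(natr1 i); move: ((1 + d) ^+ i) IH => e IH e1.
  by nra.
apply: (@le_trans _ _ (((1 + d) ^+ 3 * q) ^+ i)); last first.
  by apply: exprn_ile1 => //; rewrite mulr_ge0 // exprn_ge0 //; lra.
rewrite [leRHS]exprMn exprAC mulrAC -exprMn ler_wpM2r ?exprn_ge0 //.
by rewrite lerXn2r ?nnegrE ?mulr_ge0 ?exprn_ge0 //; lra.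
Qed.

Section Transfer.
Variables (R : realType) (r rho : R).
Hypotheses (rho_gt0 : 0 < rho) (rho_lt : rho < r).
Local Notation central := (@central R).

(* The coefficients of [(1 - x / rho) ^ (-1/2)]. *)
Definition inv_sqrt_series : {fps R} := Fps (fun n => central n / rho ^+ n).

Lemma inv_sqrt_seriesE :
  inv_sqrt_series ^+ 2 * (1 - fps_C rho^-1 * fps_X R) = 1.
Proof.
have h2 n : (inv_sqrt_series ^+ 2) n = rho ^- n.
  rewrite expr2 fps_coefM -[RHS]mul1r -(central_conv R n) mulr_suml.
  apply: eq_bigr => -[i /= iN] _; rewrite mulrACA -invfM -exprD.
  by rewrite subnKC.
apply/fpsP => n; rewrite mulrC mulrBl mul1r -mulrA fps_coefD fps_coefN fps_coefCM fps_coefXM.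
case: n => [|n]; rewrite !h2 fps_coef1 ?mulr0 ?subr0 ?expr0 ?invr1 //.
by rewrite exprS invfM subrr.
Qed.

(** The quotient is a partial sum of [a] whose term [i] is multiplied by
    [central (n - i) / central n]. This factor is within [i^3 / n] of 1, and summability at [r]
    absorbs [i^3], so the total error is of order [1 / n]. *)
Lemma transfer (a : {fps R}) l : has_value r rho a l ->
  (fun n => (a * inv_sqrt_series) n * rho ^+ n / central n) @ \oo --> l.
Proof.
move=> [[K aK] al].
pose q := rho / r.
have r0 : 0 < r by exact: lt_trans rho_lt.
have q0 : 0 <= q by rewrite divr_ge0 // ltW.
have q1 : q < 1 by rewrite ltr_pdivrMr // mul1r.
have [C cubeC] := cube_geometric_bounded q0 q1.
have C0 : 0 <= C by have := cubeC 0%N; rewrite expr0n mul0r.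
have rhoE i : rho ^+ i = r ^+ i * q ^+ i.
  by rewrite -exprMn mulrC divfK // lt0r_neq0.
have coefE n : (a * inv_sqrt_series) n * rho ^+ n / central n =
    \sum_(i < n.+1) a i * rho ^+ i * (central (n - i) / central n).
  rewrite fps_coefM mulr_suml mulr_suml; apply: eq_bigr => -[i /=]; rewrite ltnS => iN _.
  have -> : rho ^+ n = rho ^+ i * rho ^+ (n - i) by rewrite -exprD subnKC.
  have : rho ^+ (n - i) != 0 by rewrite expf_neq0 // lt0r_neq0.
  have := lt0r_neq0 (central_gt0 R n).
  move: (central n) (central (n - i)) (rho ^+ (n - i)) (rho ^+ i) => *; field.
  by apply/andP.
have dist n : `|partial_value rho n.+1 a -
    (a * inv_sqrt_series) n * rho ^+ n / central n|
    <= (K * C) / n%:R.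
  (* For [n = 0] the bound is 0, as division by zero gives 0, but the two values coincide. *)
  case: n => [|n].
    rewrite coefE /partial_value !big_ord1 /=.
    by rewrite divr1 mulr1 subrr normr0 invr0 mulr0.
  rewrite coefE /partial_value -sumrB; apply: le_trans (ler_norm_sum _ _ _) _.
  apply: (@le_trans _ _ (wnorm r n.+2 a * (C / n.+1%:R))); last first.
    by rewrite -mulrA ler_wpM2r // divr_ge0.
  rewrite mulr_suml; apply: ler_sum => -[i /=]; rewrite ltnS => iN _.
  have w0 := central_gt0 R n.+1.
  have dec : 0 <= central (n.+1 - i) / central n.+1 - 1.
    by rewrite subr_ge0 ler_pdivlMr // mul1r central_decr.
  have le3 : central (n.+1 - i) / central n.+1 - 1 <= i%:R ^+ 3 / n.+1%:R.
    rewrite ler_pdivlMr // -(ler_pM2r w0); apply: le_trans (central_sub_diff R iN).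
    by rewrite mulrAC mulrBl divfK ?lt0r_neq0 // mul1r.
  rewrite -{1}[a i * _]mulr1 -mulrBr -opprB mulrN normrN !normrM (ger0_norm dec).
  rewrite normrX (gtr0_norm rho_gt0) rhoE mulrA -mulrA.
  apply: ler_wpM2l; first by rewrite mulr_ge0 // exprn_ge0 // ltW.
  apply: le_trans (ler_wpM2l (exprn_ge0 _ q0) le3) _.
  by rewrite mulrA ler_wpM2r // mulrC.
have d0 : (fun n => partial_value rho n.+1 a -
    (a * inv_sqrt_series) n * rho ^+ n / central n) @ \oo --> (0 : R).
  apply/norm_cvg0P; apply: (@squeeze_cvgr _ _ _ _ (fun=> 0) (fun n => (K * C) / n%:R)).
  - by apply: nearW => n; rewrite normr_ge0 dist.
  - exact: cvg_cst.
  - rewrite -[X in _ --> X](mulr0 (K * C)); apply: cvgMr.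
    by rewrite -cvg_shiftS; exact: cvg_harmonic.
have al' : (fun n => partial_value rho n.+1 a) @ \oo --> l.
  by rewrite (cvg_shiftS (fun n => partial_value rho n a)).
rewrite -[X in _ --> X]subr0.
rewrite (_ : (fun n => _) = (fun n => partial_value rho n.+1 a -
  (partial_value rho n.+1 a - (a * inv_sqrt_series) n * rho ^+ n / central n))).
  exact: cvgB.
by apply/funext => n; rewrite opprB addrC subrK.
Qed.

End Transfer.

(** * Asymptotics of the number of intervals *)

Section Asymptotics.
Variable R : realType.

Let rho : R := (3 - Num.sqrt 5) / 2.
Let r : R := 2^-1.

Let sqr_sqrt5 : Num.sqrt 5 ^+ 2 = 5 :> R. Proof. by rewrite sqr_sqrtr. Qed.
Let sqrt5_gt2 : 2 < Num.sqrt 5 :> R.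
Proof. by rewrite -(ger0_norm (_ : 0 <= 2)) // -sqrtr_sqr ltr_sqrt // expr2; lra. Qed.
Let sqrt5_lt3 : Num.sqrt 5 < 3 :> R.
Proof. by rewrite -(ger0_norm (_ : 0 <= 3)) // -sqrtr_sqr ltr_sqrt // expr2; lra. Qed.
Let rho_gt0 : 0 < rho. Proof. by have := sqrt5_lt3; rewrite /rho; lra. Qed.
Let rho_lt : rho < r. Proof. by have := sqrt5_gt2; rewrite /rho /r; lra. Qed.
Let rho_sqr : rho ^+ 2 = 3 * rho - 1.
Proof.
rewrite (_ : rho ^+ 2 = (9 - 6 * Num.sqrt 5 + Num.sqrt 5 ^+ 2) / 4).
  by rewrite sqr_sqrt5 /rho; field.
by rewrite /rho; field.
Qed.
Let rhoV : rho^-1 = 3 - rho.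
Proof.
apply: (mulfI (lt0r_neq0 rho_gt0)); rewrite mulfV ?lt0r_neq0 //.
by rewrite mulrBr -expr2 rho_sqr; ring.
Qed.

Let x := fps_X R.
Let v := fps_C rho.
Let gf : {fps R} := Fps (fun n => #|intervals n|%:R).
Let e1 : {fps R} := Fps (fun n => (-1) ^+ n).
Let e2 : {fps R} := Fps (fun n => rho ^+ n).
Let h := inv_sqrt_series rho.

Let e1E : (1 + x) * e1 = 1.
Proof.
apply/fpsP => n; rewrite mulrDl mul1r fps_coefD fps_coefXM fps_coef1.
by case: n => [|n] /=; rewrite ?addr0 ?exprS ?mulN1r ?addNr.
Qed.

Let e2E : (1 - v * x) * e2 = 1.
Proof.
apply/fpsP => n; rewrite mulrBl mul1r -mulrA fps_coefD fps_coefN fps_coefCM.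
rewrite fps_coefXM fps_coef1; case: n => [|n] /=; rewrite ?mulr0 ?subr0 //.
by rewrite exprS subrr.
Qed.

(** The roots [rho] and [rho^-1] have sum 3 and product 1. *)
Let quadratic_factor : x ^+ 2 - 3 * x + 1 = (1 - fps_C rho^-1 * x) * (1 - v * x).
Proof.
have uv : fps_C rho^-1 * v = 1.
  apply/fpsP => n; rewrite fps_coefCM fps_coef1 /=.
  by case: n => [|n] /=; rewrite ?mulr0 // mulVf // lt0r_neq0.
have uDv : fps_C rho^-1 + v = 3.
  apply/fpsP => n; rewrite fps_coefD fps_coefMn fps_coef1 /=.
  by case: n => [|n] /=; rewrite ?mul0rn ?addr0 // rhoV; lra.
transitivity (1 - (fps_C rho^-1 + v) * x + (fps_C rho^-1 * v) * x ^+ 2); last by ring.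
by rewrite uv uDv; ring.
Qed.

(* The witness is [s * h], with [s] the square root in the theorem: the
   singularity of [s] at [rho] cancels. *)
Lemma intervals_factorization : exists2 g : {fps R},
    2 * (x * gf) = g * e1 * e2 * h - e1 &
    g ^+ 2 = (1 - v * x) * (1 + x + x ^+ 2) /\ g 0%N = 1.
Proof.
have [M ME] := motzkin_series R; rewrite -/x in ME.
have gfE := intervals_gf_closed ME; rewrite -/x -/gf quadratic_factor in gfE.
have hE : h ^+ 2 * (1 - fps_C rho^-1 * x) = 1 by exact: inv_sqrt_seriesE.
set s := 1 - x - x ^+ 2 - 2 * x ^+ 3 * M in gfE.
have s2 : s ^+ 2 = (x ^+ 2 - 3 * x + 1) * (1 + x + x ^+ 2).
  by rewrite (motzkin_sqrt ME); ring.
exists (s * h).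
  transitivity (e1 * e2 * h ^+ 2 *
    (gf * (2 * x * ((1 - fps_C rho^-1 * x) * (1 - v * x)) * (x + 1)))).
    transitivity (2 * (x * gf) * ((1 + x) * e1) * ((1 - v * x) * e2) *
      (h ^+ 2 * (1 - fps_C rho^-1 * x))).
      by rewrite e1E e2E hE !mulr1.
    by ring.
  rewrite gfE (_ : - x ^+ 2 + 3 * x - 1 = - (x ^+ 2 - 3 * x + 1)); last by ring.
  rewrite quadratic_factor.
  transitivity (s * h * e1 * e2 * h - e1 * ((1 - v * x) * e2) *
    (h ^+ 2 * (1 - fps_C rho^-1 * x))).
    by ring.
  by rewrite e2E hE !mulr1.
split.
  rewrite exprMn s2 quadratic_factor.
  transitivity ((1 - v * x) * (1 + x + x ^+ 2) *
    (h ^+ 2 * (1 - fps_C rho^-1 * x))); first by ring.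
  by rewrite hE mulr1.
rewrite fps_coefM0 (_ : h 0%N = 1) ?mulr1 /s; last by rewrite /= divr1.
rewrite !(fps_coefD, fps_coefN, fps_coefM0, exprS, expr0, fps_coef1) /=.
by rewrite !(mul0r, mulr0) !subr0.
Qed.

(** The limit is half the value of [g * e1 * e2] at [rho], known only through its square because [g]
    is. The index [n.+1] comes from the factor [x] of the denominator. *)
Lemma intervals_value : exists2 l : R,
  (fun n => #|intervals n|%:R * rho ^+ n.+1 / central R n.+1) @ \oo --> l &
  l ^+ 2 * ((1 + rho) ^+ 2 * (1 - rho ^+ 2)) = rho.
Proof.
have [g gE [g2 g0]] := intervals_factorization.
have r0 : 0 <= r by rewrite invr_ge0.
have r1 : r < 1 by rewrite /r; lra.
have rho1 : rho < 1 by exact: lt_trans r1.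
have sg : summable_at r g.
  (* Horner form of [1 - (1 - v x) (1 + x + x^2)]; its norm at [1/2] is at most
     [3/4 - 5 rho / 8]. *)
  pose w := fps_C (rho - 1); pose q := x * (w + x * (w + x * v)).
  have wE : w = v - 1.
    apply/fpsP => -[|n]; rewrite fps_coefD fps_coefN fps_coef1 //=.
    by rewrite subr0.
  apply: (summable_at_sqrt (q := q)) => // [|n]; first by rewrite g2 /q wE; ring.
  have wn : wnorm r n w <= 1 - rho.
    by apply: le_trans (wnormC _ _ _) _; rewrite distrC ger0_norm // subr_ge0 ltW.
  have vn : wnorm r n v <= rho.
    by apply: le_trans (wnormC _ _ _) _; rewrite gtr0_norm.
  have step a b : wnorm r n a <= b -> wnorm r n (w + x * a) <= 1 - rho + r * b.
    move=> ab; apply: le_trans (wnormD _ _ _ r0) (lerD wn _).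
    by apply: le_trans (wnormXM_le _ _ r0) _; rewrite ler_wpM2l.
  apply: le_trans (wnormXM_le _ _ r0) _.
  apply: le_trans (ler_wpM2l r0 (step _ _ (step _ _ vn))) _.
  by move: rho_gt0 rho1; move: (rho) => t t0 t1; rewrite /r; lra.
have norm1 (z : R) i : `|z| <= 1 -> `|z ^+ i| <= 1.
  by move=> z1; rewrite normrX exprn_ile1.
have [gam gv] := has_value_exists rho_gt0 rho_lt sg.
have [|eps1 v1] := @has_value_exists _ _ _ rho_gt0 rho_lt e1.
  by apply: summable_at_leq => // i; rewrite norm1 // normrN1.
have [|eps2 v2] := @has_value_exists _ _ _ rho_gt0 rho_lt e2.
  by apply: summable_at_leq => // i; rewrite norm1 // gtr0_norm // ltW.
have v0 := @has_valueC R r rho.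
have vD := @has_valueD _ r rho rho_gt0 rho_lt.
have vM := @has_valueM _ r rho rho_gt0 rho_lt.
have vN := @has_valueN _ r rho.
have vX : has_value r rho x rho.
  by have := has_valueX rho_gt0 rho_lt (v0 1); rewrite !mulr1.
have uniq := @has_value_uniq _ r rho.
have V1 : has_value r rho 1 1 := v0 1.
have Vvx : has_value r rho (1 - v * x) (1 - rho * rho).
  exact: (vD _ _ _ _ V1 (vN _ _ (vM _ _ _ _ (v0 rho) vX))).
have V1x : has_value r rho (1 + x) (1 + rho) := vD _ _ _ _ V1 vX.
have gam2 : gam ^+ 2 = (1 - rho * rho) * (1 + rho + rho * rho).
  have V := vM _ _ _ _ Vvx (vD _ _ _ _ V1x (vM _ _ _ _ vX vX)).
  by apply: uniq (vM _ _ _ _ gv gv) _; rewrite -expr2 g2.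
have eps1E : (1 + rho) * eps1 = 1.
  by apply: uniq (vM _ _ _ _ V1x v1) _; rewrite e1E.
have eps2E : (1 - rho * rho) * eps2 = 1.
  by apply: uniq (vM _ _ _ _ Vvx v2) _; rewrite e2E.
exists (gam * eps1 * eps2 / 2); last first.
  transitivity (gam ^+ 2 * ((1 + rho) * eps1) ^+ 2 * ((1 - rho * rho) * eps2) * eps2 / 4).
    by field.
  rewrite gam2 eps1E eps2E expr1n !mulr1.
  (* What remains is [1 + rho + rho^2 = 4 rho], from the quadratic equation of [rho]. *)
  transitivity ((1 + rho + rho * rho) * ((1 - rho * rho) * eps2) / 4); first by field.
  by rewrite eps2E mulr1 -expr2 rho_sqr; field.
have lim1 : (fun n => (g * e1 * e2 * h) n.+1 * rho ^+ n.+1 / central R n.+1)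
    @ \oo --> gam * eps1 * eps2.
  rewrite (cvg_shiftS (fun n => (g * e1 * e2 * h) n * rho ^+ n / central R n)).
  by apply: (transfer rho_gt0 rho_lt); exact: (vM _ _ _ _ (vM _ _ _ _ gv v1) v2).
(* The pole at -1 is negligible: [central m >= 1 / (m + 1)] decays slowly, and the bound on
   [m^3 rho^m] leaves an error of order [1 / m]. *)
have lim2 : (fun n => e1 n.+1 * rho ^+ n.+1 / central R n.+1) @ \oo --> (0 : R).
  have [C cubeC] := cube_geometric_bounded (ltW rho_gt0) rho1.
  apply/norm_cvg0P; apply: (@squeeze_cvgr _ _ _ _ (fun=> 0) (fun n => (2 * C) * harmonic n)).
  - apply: nearW => n; rewrite normr_ge0 /= /harmonic /=.
    have c0 := central_gt0 R n.+1.
    rewrite !normrM normrX normrN1 expr1n mul1r normrX (gtr0_norm rho_gt0).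
    rewrite normfV (gtr0_norm c0) ler_pdivrMr //.
    have := central_ge_inv R n.+1; have := cubeC n.+1.
    have : 1 <= n.+1%:R :> R by rewrite ler1n.
    have : 0 <= rho ^+ n.+1 by rewrite exprn_ge0 // ltW.
    have : n.+2%:R = n.+1%:R + 1 :> R by rewrite natr1.
    move: (rho ^+ n.+1) (n.+1%:R : R) (n.+2%:R) (central R n.+1) c0 => p m _ c c0 -> p0 m1 mC mc.
    rewrite mulrAC ler_pdivlMr; last by lra.
    have cC : c * (m ^+ 3 * p) <= c * C by apply: ler_wpM2l => //; exact: ltW.
    have h1 : p * m <= p * m * (m + 1) * c.
      by rewrite -mulrA ler_peMr // mulr_ge0 //; lra.
    have h2 : p * m * (m + 1) * c <= 2 * (c * (m ^+ 3 * p)).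
      rewrite (_ : 2 * _ = p * m * c * (2 * m ^+ 2)); last by ring.
      rewrite [leLHS](_ : _ = p * m * c * (m + 1)); last by ring.
      apply: ler_wpM2l; last by nra.
      by rewrite !mulr_ge0 // ?(ltW c0) //; lra.
    by lra.
  - exact: cvg_cst.
  - rewrite -[X in _ --> X](mulr0 (2 * C)); apply: cvgMr; exact: cvg_harmonic.
rewrite (_ : (fun n => _) = (fun n => ((g * e1 * e2 * h) n.+1 * rho ^+ n.+1 / central R n.+1
   - e1 n.+1 * rho ^+ n.+1 / central R n.+1) / 2)).
  rewrite -[X in X / 2]subr0; apply: cvgMl; exact: cvgB.
apply/funext => n; rewrite -!mulrBl.
have -> : (g * e1 * e2 * h) n.+1 - e1 n.+1 = 2 * #|intervals n|%:R.
  rewrite -fps_coefN -fps_coefD -gE (_ : 2 * _ = (x * gf) *+ 2); last by ring.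
  by rewrite fps_coefMn fps_coefXM /= mulr_natl.
by field; rewrite lt0r_neq0 // central_gt0.
Qed.

Lemma central_sqrt_cvg :
  (fun n => central R n.+1 * Num.sqrt n%:R) @ \oo --> Num.sqrt pi^-1.
Proof.
rewrite (_ : (fun n => _) = (fun n => Num.sqrt (central R n.+1 ^+ 2 * n%:R))); last first.
  by apply/funext => n; rewrite sqrtrM ?sqr_ge0 // sqrtr_sqr gtr0_norm // central_gt0.
apply: continuous_cvg; first exact: sqrt_continuous.
have p0 := pi_gt0 R.
(* Wallis gives the lower bound [2n / (2n + 3) = 1 - 3 / (2n + 3)] up to the factor [1 / pi], and
   [3 / (2n + 3) <= 2 / (n + 1)]. *)
apply: (@squeeze_cvgr _ _ _ _ (fun n => pi^-1 * (1 - 2 * harmonic n)) (fun=> pi^-1)).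
- apply: nearW => n; rewrite /harmonic /=.
  have n0 := ler0n R n; have nS : n.+1%:R = n%:R + 1 :> R by rewrite natr1.
  have le1 := @central_sqr_le R n.+1 isT; have ge1 := central_sqr_ge R n.+1.
  rewrite nS in le1 ge1 *; move: (n%:R) (central R n.+1 ^+ 2) (pi) p0 n0 le1 ge1.
  move=> m c p p0 m0 le1 ge1; apply/andP; split.
    apply: le_trans (ler_wpM2r m0 ge1).
    rewrite [leRHS](_ : _ = p^-1 * (2 * m / (2 * (m + 1) + 1))); last by rewrite invfM; ring.
    apply: ler_wpM2l; first by rewrite invr_ge0 ltW.
    rewrite ler_pdivlMr; last by lra.
    have : (m + 1) * (m + 1)^-1 = 1 by rewrite mulfV // lt0r_neq0 //; lra.
    have : 0 <= (m + 1)^-1 by rewrite invr_ge0; lra.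
    by move: ((m + 1)^-1) => i i0 mi; nra.
  apply: le_trans (ler_wpM2r m0 le1) _; rewrite invfM -mulrA.
  rewrite ler_piMr ?invr_ge0 ?(ltW p0) //.
  by rewrite mulrC ler_pdivrMr ?mul1r; lra.
- rewrite -[X in _ --> X]mulr1; apply: cvgMr; rewrite -[X in _ --> X]subr0.
  apply: cvgB; first exact: cvg_cst.
  by rewrite -[X in _ --> X](mulr0 2); apply: cvgMr; exact: cvg_harmonic.
- exact: cvg_cst.
Qed.

Lemma equivalent_of_ratio (f g : nat -> R) :
    (\forall n \near \oo, g n != 0) -> (fun n => f n / g n) @ \oo --> (1 : R) ->
  f ~_\oo g.
Proof.
move=> g0 fg; apply/eqaddoP => _/posnumP[e].
have /cvgrPdist_le/(_ e%:num (gt0 e)) fg1 := fg.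
near=> n.
have gn : g n != 0 by near: n.
rewrite !fctE.
have -> : f n - g n = - ((1 - f n / g n) * g n) by rewrite mulrBl divfK // mul1r opprB.
rewrite normrN normrM ler_wpM2r //.
by near: n.
Unshelve. all: by end_near. Qed.

Lemma intervals_asymptotics :
  (fun n : nat => #|intervals n|%:R : R) ~_\oo
  (fun n : nat =>
    (11 + 5 * Num.sqrt 5) / 20 * Num.sqrt ((14 * Num.sqrt 5 - 30) / pi) *
    (n%:R `^ (- (1 / 2))) * ((3 + Num.sqrt 5) / 2) ^+ n).
Proof.
have [l lim lE] := intervals_value.
set K := (11 + 5 * Num.sqrt 5) / 20; set X := 14 * Num.sqrt 5 - 30.
have s5 := sqrt5_gt2; have s52 := sqr_sqrt5.
have X0 : 0 < X.
  rewrite /X; move: (Num.sqrt 5) s5 s52 => s s2 ss; nra.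
have K0 : 0 < K by rewrite /K; lra.
have l0 : 0 <= l.
  apply: (cvgr_to_ge lim); apply: nearW => n.
  by rewrite divr_ge0 ?mulr_ge0 ?exprn_ge0 // ltW // central_gt0.
have lKX : l = rho * K * Num.sqrt X.
  have rKX0 : 0 <= rho * K * Num.sqrt X.
    apply: mulr_ge0; last exact: sqrtr_ge0.
    by apply: mulr_ge0; apply: ltW; [exact: rho_gt0|].
  (* Both sides are nonnegative, so it suffices to compare squares, by arithmetic in the field
     generated by the square root of 5. *)
  apply/eqP; rewrite -(@eqrXn2 _ 2) //; apply/eqP.
  rewrite 2!exprMn sqr_sqrtr ?ltW //.
  have D : (1 + rho) ^+ 2 * (1 - rho ^+ 2) = 5 / 4 * X.
    have -> : (1 + rho) ^+ 2 = (15 - 5 * Num.sqrt 5) / 2 by rewrite /rho; lra.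
    have -> : 1 - rho ^+ 2 = (3 * Num.sqrt 5 - 5) / 2 by rewrite /rho; lra.
    by rewrite /X; lra.
  have D0 : 5 / 4 * X != 0 by rewrite mulf_neq0 // lt0r_neq0.
  rewrite D in lE; apply: (mulIf D0); rewrite lE.
  transitivity (rho * (rho * (K ^+ 2 * X ^+ 2) * (5 / 4))); last by ring.
  have -> : K ^+ 2 = (246 + 110 * Num.sqrt 5) / 400 by rewrite /K; lra.
  have -> : X ^+ 2 = 1880 - 840 * Num.sqrt 5 by rewrite /X; lra.
  rewrite (_ : _ / 400 * _ = (6 + 2 * Num.sqrt 5) / 5); last by lra.
  by rewrite (_ : rho * _ * _ = 1) ?mulr1 // /rho; lra.
have c0 : 0 < K * Num.sqrt (X / pi).
  by rewrite mulr_gt0 // sqrtr_gt0 divr_gt0 // pi_gt0.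
have rhoVE : (3 + Num.sqrt 5) / 2 = rho^-1 by rewrite rhoV /rho; field.
have powE n : n%:R `^ (- (1 / 2)) = (Num.sqrt n%:R)^-1 :> R.
  by rewrite powRN div1r powR12_sqrt.
apply: equivalent_of_ratio.
  near=> n.
  have n0 : (0 < n)%N by near: n; exact: nbhs_infty_gt.
  rewrite powE rhoVE; apply: mulf_neq0.
    apply: mulf_neq0; first exact: lt0r_neq0.
    by rewrite invr_eq0 lt0r_neq0 // sqrtr_gt0 ltr0n.
  by rewrite expf_neq0 // invr_eq0 lt0r_neq0.
set c := K * _ in c0 *.
have rc0 : rho * c != 0 by rewrite mulf_neq0 // lt0r_neq0.
(* The factor [central] cancels between the two limits, leaving the count times [rho ^+ n.+1] and
   the square root of [n]. *)
have lim_c : (fun n => #|intervals n|%:R * rho ^+ n.+1 / central R n.+1 *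
    (central R n.+1 * Num.sqrt n%:R)) @ \oo --> rho * c.
  have -> : rho * c = l * Num.sqrt pi^-1.
    by rewrite lKX /c sqrtrM ?(ltW X0) //; ring.
  exact: cvgM lim central_sqrt_cvg.
have : (fun n => #|intervals n|%:R * rho ^+ n.+1 / central R n.+1 *
    (central R n.+1 * Num.sqrt n%:R) * (rho * c)^-1) @ \oo --> (1 : R).
  by rewrite -[X in _ --> X](mulfV rc0); apply: cvgMl; exact: lim_c.
apply: cvg_trans; apply: near_eq_cvg; near=> n.
have n0 : (0 < n)%N by near: n; exact: nbhs_infty_gt.
rewrite powE rhoVE.
have sn : Num.sqrt n%:R != 0 :> R by rewrite lt0r_neq0 // sqrtr_gt0 ltr0n.
have cn := lt0r_neq0 (central_gt0 R n.+1).
have rn : rho ^+ n != 0 by rewrite expf_neq0 // lt0r_neq0.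
have t0 : rho != 0 by exact: lt0r_neq0.
have d0 := lt0r_neq0 c0.
rewrite exprVn exprS.
move: (rho) rn t0 (c) d0 (central R n.+1) cn (Num.sqrt n%:R) sn.
move=> t tn t0 d d0 w w0 q q0.
by field; rewrite tn q0 d0 t0 w0.
Unshelve. all: by end_near. Qed.

End Asymptotics.

Theorem theorem4p7 (R : realType) :
  [/\ let x := var_x rat in
      let y := var_y rat in
      let s := fps_sqrt (x ^+ 4 - 2 * x ^+ 3 - x ^+ 2 - 2 * x + 1) in
      gf_j%:F =
        (1 + x - x ^+ 2 + s)%:F /
        ((1 - x ^+ 2) * s + 1 + x ^+ 4 - x ^+ 3 - 2 * (y + 1) * x ^+ 2 - x)%:F,
      let x := fps_X rat in
      let s := fps_sqrt (x ^+ 4 - 2 * x ^+ 3 - x ^+ 2 - 2 * x + 1) in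
      gf_intervals%:F =
        (- x ^+ 2 + 3 * x - 1 + s)%:F /
        (2 * x * (x ^+ 2 - 3 * x + 1) * (x + 1))%:F
    & (fun n : nat => #|intervals n|%:R : R) ~_\oo
      (fun n : nat =>
        (11 + 5 * Num.sqrt 5) / 20 * Num.sqrt ((14 * Num.sqrt 5 - 30) / pi) *
        (n%:R `^ (- (1 / 2))) * ((3 + Num.sqrt 5) / 2) ^+ n)].
Proof.
split; [exact: gf_j_closed|exact: gf_intervals_closed|].
exact: intervals_asymptotics.
Qed.
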